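(* Let $D\subset\mathbb{C}^N$ be a (possibly unbounded) convex domain. If there exist $p\in\partial D$ and a separating hyperplane $H_p$ of $D$ at $p$ such that $$\big((H_p\cap\partial D)-p\big)\cap i\big((H_p\cap\partial D)-p\big)$$ does not contain any complex affine line, then $D$ is complete hyperbolic. Conversely, if $D$ is complete hyperbolic, then for any point $p\in\partial D$ and any separating hyperplane $H_p$ of $D$ at $p$, the set $\big((H_p\cap\partial D)-p\big)\cap i\big((H_p\cap\partial D)-p\big)$ does not contain any complex affine line.
   Context: Let $\mathbb{D}$ be the open unit disc in $\mathbb{C}$. For a domain $D\subset\mathbb{C}^N$, the Kobayashi pseudo-metric is $\kappa_D(z;v)=\inf\{\lambda>0:\exists\,\varphi:\mathbb{D}\to D \text{ holomorphic},\ \varphi(0)=z,\ \varphi'(0)=v/\lambda\}$, and the Kobayashi pseudodistance $k_D$ is obtained by integrating $\kappa_D$ (infimum of $\kappa_D$-lengths of curves joining two points). $D$ is complete hyperbolic if $k_D$ is a complete distance on $D$. A (real) separating hyperplane of $D$ at $p\in\partial D$ is a set $H_p=\{z\in\mathbb{C}^N:\mathrm{Re}\,L(z)=a\}$, with $L$ a nonzero complex linear functional and $a\in\mathbb{R}$, such that $p\in H_p$ and $D\cap H_p=\emptyset$. For $E\subset\mathbb{C}^N$, $E-p=\{z-p:z\in E\}$ and $iE=\{iz:z\in E\}$. A complex affine line is a set $\{q+\zeta v:\zeta\in\mathbb{C}\}$ with $q,v\in\mathbb{C}^N$, $v\neq 0$. *)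

(* Defs.v *)
From HB Require Import structures.
From mathcomp Require Import all_boot all_order all_algebra.
From mathcomp Require Import all_classical all_reals all_analysis.
From mathcomp Require Export complex.

Set Implicit Arguments.
Unset Strict Implicit.
Unset Printing Implicit Defensive.

Import Order.TTheory GRing.Theory Num.Theory.
Import numFieldNormedType.Exports.

Local Open Scope classical_set_scope.
Local Open Scope ring_scope.
Local Open Scope complex_scope.

(* R[i] is a normed module over itself, its topology being given by the modulus;
   this follows what the library does for its abstract numFieldTypes. *)
HB.instance Definition _ (R : rcfType) := NormedModule.copy R[i] R[i]^o.

(* C^N is 'rV[R[i]]_N, with the topology of the max norm. *)

Section Domains.
Context {R : realType} {N : nat}.
Implicit Types (D E H : set 'rV[R[i]]_N) (p : 'rV[R[i]]_N).

Definition is_domain D := [/\ D !=set0, open D & connected D].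

(* The weights {i01 R[i]} of the library's convex_set are the x : R[i] with
   0 <= x <= 1; the order of R[i] forces them to be real, so this is ordinary
   (real) convexity. *)
Definition is_convex D := convex_set (D : set (convex_lmodType 'rV[R[i]]_N)).

Definition boundary D := closure D `\` D°.

Definition separating_hyperplane D p H :=
  exists (L : {scalar 'rV[R[i]]_N}) (a : R),
    [/\ exists z, L z != 0,
        H = [set z | complex.Re (L z) = a],
        H p &
        D `&` H = set0].

Definition translate E p := [set z - p | z in E].

Definition imul E := [set 'i *: z | z in E].

Definition is_complex_affine_line E :=
  exists q v : 'rV[R[i]]_N, v != 0 /\ E = [set q + zeta *: v | zeta in setT].

Definition contains_complex_affine_line E :=
  exists2 l, is_complex_affine_line l & l `<=` E.

End Domains.

Section Kobayashi.
Context {R : realType} {N : nat}.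
Implicit Types (D : set 'rV[R[i]]_N) (x y z v : 'rV[R[i]]_N).
Implicit Types (phi : R[i] -> 'rV[R[i]]_N) (g : R -> 'rV[R[i]]_N).

(* The values of phi outside the unit disc are irrelevant. *)
Definition holomorphic_disc D phi :=
  forall z : R[i], `|z| < 1 -> derivable phi z 1 /\ D (phi z).

Local Open Scope ereal_scope.

Definition kobayashi_metric D z v : \bar R :=
  ereal_inf [set lam%:E | lam in [set lam : R | (0 < lam)%R /\
    exists phi, [/\ holomorphic_disc D phi, phi 0%R = z &
                    derive1 phi 0%R = (lam^-1)%:C *: v]]].

(* 'rV[R[i]]_N is a normed module over R[i] only, so derivatives with respect
   to a real parameter are taken on real and imaginary parts. *)
Definition re_coord g (j : 'I_N) (t : R) : R := complex.Re (g t ord0 j).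

Definition im_coord g (j : 'I_N) (t : R) : R := complex.Im (g t ord0 j).

Definition velocity g (t : R) : 'rV[R[i]]_N :=
  \row_j (derive1 (re_coord g j) t +i* derive1 (im_coord g j) t).

Definition C1_fun (f : R -> R) :=
  (forall t, derivable f t 1%R) /\ continuous (derive1 f).

(* A C^1 map on [0, 1], given as the restriction of a C^1 map on R. *)
Definition C1_arc D g :=
  [/\ forall j, C1_fun (re_coord g j),
      forall j, C1_fun (im_coord g j) &
      forall t : R, (0 <= t <= 1)%R -> D (g t)].

(* A piecewise C^1 curve in D from x to y is given by the list of its C^1
   pieces, each parametrized by [0, 1] and starting where the previous one
   ends; the empty list is the constant curve. *)
Fixpoint curve D x y (s : seq (R -> 'rV[R[i]]_N)) : Prop :=
  if s is g :: s' then [/\ C1_arc D g, g 0%R = x & curve D (g 1%R) y s']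
  else x = y.

Definition kobayashi_length D (s : seq (R -> 'rV[R[i]]_N)) : \bar R :=
  \sum_(g <- s) \int[@lebesgue_measure R]_(t in `[0%R, 1%R])
                   kobayashi_metric D (g t) (velocity g t).

Definition kobayashi_dist D x y : \bar R :=
  ereal_inf [set kobayashi_length D s | s in [set s | curve D x y s]].

Definition is_distance_on D (d : 'rV[R[i]]_N -> 'rV[R[i]]_N -> \bar R) :=
  [/\ forall x y, D x -> D y -> 0 <= d x y < +oo,
      forall x y, D x -> D y -> d x y = 0 <-> x = y,
      forall x y, D x -> D y -> d x y = d y x &
      forall x y z, D x -> D y -> D z -> d x z <= d x y + d y z].

Definition cauchy_seq_for (d : 'rV[R[i]]_N -> 'rV[R[i]]_N -> \bar R)
    (u : nat -> 'rV[R[i]]_N) :=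
  forall e : R, (0 < e)%R ->
    exists n0, forall m n, (n0 <= m)%N -> (n0 <= n)%N -> d (u m) (u n) < e%:E.

Definition complete_distance_on D d :=
  is_distance_on D d /\
  forall u : nat -> 'rV[R[i]]_N, (forall n, D (u n)) -> cauchy_seq_for d u ->
    exists2 x, D x & d (u n) x @[n --> \oo] --> (0 : \bar R).

Definition complete_hyperbolic D := complete_distance_on D (kobayashi_dist D).

End Kobayashi.

(* Main.v *)
(* For a convex domain both conditions amount to the absence of complex lines in
   D. If the closure of D contains a line of direction v then D + Cv is contained
   in D, so the Kobayashi metric vanishes along v and k_D is not a distance;
   conversely a complex line in D can be translated to p, where it lies in H_p
   and in the boundary of D.

   If D contains no complex line, then by strict separation N linearly
   independent affine functions W map D into the right half-plane. Cauchy's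
   estimate, applied to Re w0 / (W + conj w0) along discs and integrated along
   curves, bounds the pseudo-hyperbolic distance
   |W y - W x| / |W y + conj (W x)| by a constant multiple of k_D(x, y). A Cauchy
   sequence for k_D therefore converges in C^N, and its limit is not a boundary
   point, since the half-planes are complete; near an interior point k_D is
   controlled by the norm. Holomorphic discs being only complex differentiable,
   the estimate rests on Goursat's argument for rectangles. *)
Require Import Defs.
From mathcomp Require Import all_boot all_order all_algebra.
From mathcomp Require Import all_classical all_reals all_analysis.
From mathcomp Require Import measurable_realfun ring lra.

Set Implicit Arguments.
Unset Strict Implicit.
Unset Printing Implicit Defensive.

Import Order.TTheory GRing.Theory Num.Theory.
Import numFieldNormedType.Exports.

Local Open Scope classical_set_scope.
Local Open Scope ring_scope.
Local Open Scope complex_scope.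

(** * Goursat's lemma for rectangles *)

(** Cauchy's estimate, unlike the Schwarz lemma, asks for no normalization at the centre of the
    disc. A single function [cayley] therefore bounds the Kobayashi metric at all points of a curve
    at once, and integrating its differential gives a bound that depends on the end points only. The
    price is a constant factor, harmless because completeness only looks at small distances. The
    exponential turns circles around 0 into vertical segments, so rectangles are the only contours;
    integrals along their sides are differences of antiderivatives, estimated by the mean value
    theorem. The Kobayashi metric is not shown to be measurable along a curve. Its integral is
    therefore handled through the simple functions below it, both for the lower bound and for the
    symmetry of the distance. *)

Section RectangleIntegral.
Context {R : realType}.
Implicit Types (P Q A B : R -> R -> R) (a c w h x y : R).

Lemma mvt_bound (f df : R -> R) (a b M : R) : a <= b ->
  (forall x, a <= x <= b -> is_derive x 1 f (df x)) ->
  (forall x, a <= x <= b -> `|df x| <= M) ->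
  `|f b - f a| <= M * (b - a).
Proof.
move=> ab fd dfM.
have fd' x : x \in `]a, b[%R -> is_derive x 1 f (df x).
  by rewrite in_itv /= => /andP[ax xb]; apply: fd; rewrite !ltW.
have fc : {within `[a, b], continuous f}.
  apply: derivable_within_continuous => x; rewrite in_itv /= => /fd dfx.
  exact: ex_derive.
have [x] := MVT_segment ab fd' fc.
rewrite in_itv /= => /dfM dfxM ->.
by rewrite normrM [X in _ * X]ger0_norm ?subr_ge0 // ler_wpM2r ?subr_ge0.
Qed.

(* If [P] is an antiderivative of [A] in the first variable and [Q] one of [B]
   in the second, this is the integral of [A dx + B dy] along the boundary of
   [a, a + w] x [c, c + h]. *)
Definition rect_int P Q a c w h :=
  (P (a + w) c - P a c) - (P (a + w) (c + h) - P a (c + h))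
  + (Q (a + w) (c + h) - Q (a + w) c) - (Q a (c + h) - Q a c).

Lemma rect_int_split P Q a c w h :
  rect_int P Q a c w h =
  rect_int P Q a c (w / 2) (h / 2)
  + rect_int P Q (a + w / 2) c (w / 2) (h / 2)
  + rect_int P Q a (c + h / 2) (w / 2) (h / 2)
  + rect_int P Q (a + w / 2) (c + h / 2) (w / 2) (h / 2).
Proof.
rewrite /rect_int.
have -> : a + w / 2 + w / 2 = a + w by lra.
have -> : c + h / 2 + h / 2 = c + h by lra.
ring.
Qed.

Lemma rect_int_quarter P Q a c w h : exists i j : bool,
  `|rect_int P Q a c w h| <=
  4 * `|rect_int P Q (a + i%:R * (w / 2)) (c + j%:R * (h / 2)) (w / 2) (h / 2)|.
Proof.
apply: contrapT => H; pose q (i j : bool) :=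
  `|rect_int P Q (a + i%:R * (w / 2)) (c + j%:R * (h / 2)) (w / 2) (h / 2)|.
have lt_q i j : q i j < `|rect_int P Q a c w h| / 4.
  rewrite ltNge; apply/negP => le_q; apply: H; exists i, j.
  by rewrite mulrC -ler_pdivrMr.
have := lt_q false false; have := lt_q true false.
have := lt_q false true; have := lt_q true true.
rewrite /q !mul0r !mul1r !addr0 (rect_int_split P Q a c w h).
move: (rect_int P Q a c _ _) (rect_int P Q (a + _) c _ _)
  (rect_int P Q a (c + _) _ _) (rect_int P Q (a + _) (c + _) _ _) => r1 r2 r3 r4.
have := ler_normD (r1 + r2 + r3) r4; have := ler_normD (r1 + r2) r3.
have := ler_normD r1 r2; lra.
Qed.

Definition in_rect a c w h x y := a <= x <= a + w /\ c <= y <= c + h.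

(* Affine forms with symmetric derivative are closed, so only the errors
   contribute. *)
Lemma rect_int_bound P Q A B a c w h (x0 y0 A0 B0 al be ga e : R) :
  0 <= w -> 0 <= h ->
  (forall x y, in_rect a c w h x y -> is_derive x 1 (P ^~ y) (A x y)) ->
  (forall x y, in_rect a c w h x y -> is_derive y 1 (Q x) (B x y)) ->
  (forall x y, in_rect a c w h x y ->
     `|A x y - (A0 + al * (x - x0) + be * (y - y0))| <= e) ->
  (forall x y, in_rect a c w h x y ->
     `|B x y - (B0 + be * (x - x0) + ga * (y - y0))| <= e) ->
  `|rect_int P Q a c w h| <= 2 * e * (w + h).
Proof.
move=> w0 h0 dP dQ eA eB.
have aw : a <= a + w by rewrite lerDl.
have ch : c <= c + h by rewrite lerDl.
have horizontal y : c <= y <= c + h ->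
  `|(P (a + w) y - P a y) - (A0 + be * (y - y0)) * w
    - al / 2 * ((a + w - x0) ^+ 2 - (a - x0) ^+ 2)| <= e * w.
  (* [f] is [P] minus an antiderivative of the affine approximation of [A], so its derivative is
     bounded by [e]. *)
  move=> cy; pose f x := P x y -
     ((A0 + be * (y - y0)) * x + al / 2 * (x - x0) ^+ 2).
  have -> : (P (a + w) y - P a y) - (A0 + be * (y - y0)) * w
    - al / 2 * ((a + w - x0) ^+ 2 - (a - x0) ^+ 2) = f (a + w) - f a.
    rewrite /f; ring.
  have -> : e * w = e * (a + w - a) by ring.
  apply: (@mvt_bound _
    (fun x => A x y - (A0 + al * (x - x0) + be * (y - y0)))) => //.
    move=> x ax; have dPx := dP x y (conj ax cy).
    apply: is_derive_eq; rewrite /GRing.scale /=; lra.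
  by move=> x ax; exact: eA.
have vertical x : a <= x <= a + w ->
  `|(Q x (c + h) - Q x c) - (B0 + be * (x - x0)) * h
    - ga / 2 * ((c + h - y0) ^+ 2 - (c - y0) ^+ 2)| <= e * h.
  move=> ax; pose f y := Q x y -
     ((B0 + be * (x - x0)) * y + ga / 2 * (y - y0) ^+ 2).
  have -> : (Q x (c + h) - Q x c) - (B0 + be * (x - x0)) * h
    - ga / 2 * ((c + h - y0) ^+ 2 - (c - y0) ^+ 2) = f (c + h) - f c.
    rewrite /f; ring.
  have -> : e * h = e * (c + h - c) by ring.
  apply: (@mvt_bound _
    (fun y => B x y - (B0 + be * (x - x0) + ga * (y - y0)))) => //.
    move=> y cy; have dQy := dQ x y (conj ax cy).
    apply: is_derive_eq; rewrite /GRing.scale /=; lra.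
  by move=> y cy; exact: eB.
have cc : c <= c <= c + h by rewrite lexx.
have chc : c <= c + h <= c + h by rewrite lexx andbT.
have aa : a <= a <= a + w by rewrite lexx.
have awa : a <= a + w <= a + w by rewrite lexx andbT.
(* The terms in [al] and [ga] cancel between opposite sides, and the two terms [be * w * h] cancel
   each other. *)
have /ler_normlP[] := horizontal c cc.
have /ler_normlP[] := horizontal (c + h) chc.
have /ler_normlP[] := vertical a aa.
have /ler_normlP[] := vertical (a + w) awa.
rewrite /rect_int => ? ? ? ? ? ? ? ?.
by apply/ler_normlP; split; lra.
Qed.

Lemma nested_segments (s : nat -> R) w : 0 <= w ->
  (forall n, s n <= s n.+1) ->
  (forall n, s n.+1 + w / 2 ^+ n.+1 <= s n + w / 2 ^+ n) ->
  exists x, forall n, s n <= x <= s n + w / 2 ^+ n.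
Proof.
move=> w0 s_incr t_decr.
have wn n : 0 <= w / 2 ^+ n by rewrite divr_ge0 // exprn_ge0.
have s_mono m n : (m <= n)%N -> s m <= s n.
  by move=> mn; have := homo_leq (@lexx _ _) (@le_trans _ _) s_incr mn.
have t_mono m n : (m <= n)%N -> s n + w / 2 ^+ n <= s m + w / 2 ^+ m.
  move=> mn; pose t n := - (s n + w / 2 ^+ n).
  have t_incr k : t k <= t k.+1 by rewrite lerN2.
  by have := homo_leq (@lexx _ _) (@le_trans _ _) t_incr mn; rewrite lerN2.
have st m n : s m <= s n + w / 2 ^+ n.
  have := s_mono _ _ (leq_maxl m n); have := t_mono _ _ (leq_maxr m n).
  have := wn (maxn m n); lra.
exists (sup (range s)) => n; apply/andP; split.
  apply: ub_le_sup; last by exists n.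
  by exists (s 0%N + w / 2 ^+ 0) => _ [m _ <-]; exact: st.
by apply: ge_sup; [exists (s 0%N), 0%N | move=> _ [m _ <-]; exact: st].
Qed.

(* Goursat's bisection argument: [A] and [B] are only assumed to be
   differentiable, with dA/dy = dB/dx, at each point. *)
Theorem goursat P Q A B a c w h : 0 <= w -> 0 <= h ->
  (forall x y, in_rect a c w h x y -> is_derive x 1 (P ^~ y) (A x y)) ->
  (forall x y, in_rect a c w h x y -> is_derive y 1 (Q x) (B x y)) ->
  (forall x0 y0, in_rect a c w h x0 y0 -> exists al be ga : R,
    forall e, 0 < e -> exists2 d, 0 < d &
      forall x y, in_rect a c w h x y -> `|x - x0| < d -> `|y - y0| < d ->
      `|A x y - (A x0 y0 + al * (x - x0) + be * (y - y0))|
         <= e * (`|x - x0| + `|y - y0|) /\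
      `|B x y - (B x0 y0 + be * (x - x0) + ga * (y - y0))|
         <= e * (`|x - x0| + `|y - y0|)) ->
  rect_int P Q a c w h = 0.
Proof.
move=> w0 h0 dP dQ diffAB.
pose wn n := w / 2 ^+ n; pose hn n := h / 2 ^+ n.
have p2 n : (0 : R) < 2 ^+ n by rewrite exprn_gt0.
have wn0 n : 0 <= wn n by rewrite divr_ge0 // ltW.
have hn0 n : 0 <= hn n by rewrite divr_ge0 // ltW.
have wnS n : wn n.+1 = wn n / 2 by rewrite /wn exprSr invfM mulrA.
have hnS n : hn n.+1 = hn n / 2 by rewrite /hn exprSr invfM mulrA.
(* [np] is a level with the lower left corner of the current rectangle, [q] the corner of the
   quarter chosen next. *)
pose is_step (np : nat * (R * R)) (q : R * R) :=
    [/\ np.2.1 <= q.1, q.1 + wn np.1.+1 <= np.2.1 + wn np.1,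
        np.2.2 <= q.2, q.2 + hn np.1.+1 <= np.2.2 + hn np.1 &
        `|rect_int P Q np.2.1 np.2.2 (wn np.1) (hn np.1)| <=
        4 * `|rect_int P Q q.1 q.2 (wn np.1.+1) (hn np.1.+1)|].
have [step stepP] : {step : nat * (R * R) -> R * R & forall np,
    is_step np (step np)}.
  apply: choice; rewrite /is_step.
  move=> [n [a1 c1]] /=.
  have [i [j ij]] := rect_int_quarter P Q a1 c1 (wn n) (hn n).
  exists (a1 + i%:R * (wn n / 2), c1 + j%:R * (hn n / 2)); rewrite /= wnS hnS.
  have := wn0 n; have := hn0 n => ? ?.
  by split => //; case: (i) (j) => -[] /=; lra.
pose s := fix s n := if n is m.+1 then step (m, s m) else (a, c).
have sP n : is_step (n, s n) (s n.+1) := stepP (n, s n).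
have [x0 x0P] : exists x, forall n, (s n).1 <= x <= (s n).1 + w / 2 ^+ n.
  by apply: nested_segments => // n; have [] := sP n.
have [y0 y0P] : exists y, forall n, (s n).2 <= y <= (s n).2 + h / 2 ^+ n.
  by apply: nested_segments => // n; have [] := sP n.
have sub n x y : in_rect (s n).1 (s n).2 (wn n) (hn n) x y -> in_rect a c w h x y.
  elim: n x y => [|n IH] x y; first by rewrite /wn /hn !expr0 !divr1.
  move=> [/andP[? ?] /andP[? ?]]; apply: IH; have [/= ? ? ? ? _] := sP n.
  by split; apply/andP; split; lra.
have s_le n : `|rect_int P Q a c w h| <=
    4 ^+ n * `|rect_int P Q (s n).1 (s n).2 (wn n) (hn n)|.
  elim: n => [|n IH]; first by rewrite expr0 mul1r /wn /hn !expr0 !divr1.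
  apply: le_trans IH _; rewrite exprSr -mulrA ler_wpM2l ?exprn_ge0 //.
  by have [] := sP n.
have in0 : in_rect a c w h x0 y0 by apply: (sub 0%N); split; [exact: x0P | exact: y0P].
have [al [be [ga diff0]]] := diffAB _ _ in0.
apply/eqP; rewrite -normr_le0; apply/ler_addgt0Pr => e e0; rewrite add0r.
(* The [+ 1] keeps the denominator positive when the rectangle is degenerate. *)
pose e' := e / (2 * (w + h + 1) ^+ 2).
have wh1 : 0 < w + h + 1 by rewrite ltr_wpDl // addr_ge0.
have e'0 : 0 < e' by rewrite divr_gt0 // mulr_gt0 // exprn_gt0.
have [d d0 dP'] := diff0 _ e'0.
have [n nd] : exists n, (w + h) / 2 ^+ n < d.
  have [n _ /(_ n (leqnn _)) nP] : \forall n \near \oo, (w + h) / 2 ^+ n < d.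
    have : (fun n => (w + h) * (2^-1) ^+ n) @ \oo --> (w + h) * 0.
      apply: cvgMr; apply: cvg_expr; rewrite ger0_norm //; lra.
    rewrite mulr0 => /cvgrPdist_lt /(_ _ d0); apply: filterS => n.
    rewrite sub0r normrN exprVn ger0_norm //.
    by apply: divr_ge0; [exact: addr_ge0 | exact: ltW].
  by exists n.
apply: (le_trans (s_le n)).
have bnd x y : in_rect (s n).1 (s n).2 (wn n) (hn n) x y ->
    `|x - x0| <= wn n /\ `|y - y0| <= hn n.
  have := x0P n; have := y0P n; rewrite -/(wn n) -/(hn n).
  move=> /andP[? ?] /andP[? ?] [/andP[? ?] /andP[? ?]].
  by split; apply/ler_normlP; split; lra.
have whd : wn n + hn n < d by rewrite /wn /hn -mulrDl.
have near0 x y : in_rect (s n).1 (s n).2 (wn n) (hn n) x y ->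
    [/\ in_rect a c w h x y, `|x - x0| < d, `|y - y0| < d &
    `|x - x0| + `|y - y0| <= wn n + hn n].
  move=> xy; have [? ?] := bnd x y xy; have := wn0 n; have := hn0 n => ? ?.
  split; [exact: sub xy | lra | lra | lra].
have := @rect_int_bound P Q A B (s n).1 (s n).2 (wn n) (hn n) x0 y0 (A x0 y0)
  (B x0 y0) al be ga (e' * (wn n + hn n)) (wn0 n) (hn0 n)
  (fun x y xy => dP x y (sub n x y xy)) (fun x y xy => dQ x y (sub n x y xy)).
move=> /(_ _ _)/le_trans-H.
rewrite mulrC -ler_pdivlMr ?exprn_gt0 //; apply: H.
- move=> x y /near0[xy xd yd le_xy]; have [+ _] := dP' x y xy xd yd.
  by move=> /le_trans; apply; rewrite ler_pM2l.
- move=> x y /near0[xy xd yd le_xy]; have [_] := dP' x y xy xd yd.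
  by move=> /le_trans; apply; rewrite ler_pM2l.
(* The error is quadratic in the side lengths, so the factor [4 ^+ n] of the bisection cancels. *)
rewrite ler_pdivlMr ?exprn_gt0 //.
have -> : 2 * (e' * (wn n + hn n)) * (wn n + hn n) * 4 ^+ n =
    2 * e' * (w + h) ^+ 2.
  have -> : (4 : R) ^+ n = 2 ^+ n * 2 ^+ n by rewrite -exprMn; congr (_ ^+ _); ring.
  rewrite /wn /hn; field; exact: lt0r_neq0.
have -> : e = 2 * e' * (w + h + 1) ^+ 2.
  rewrite /e'; field; exact: lt0r_neq0.
apply: ler_wpM2l; first by rewrite mulr_ge0 // ltW.
rewrite ler_sqr ?nnegrE; lra.
Qed.

End RectangleIntegral.

(** * Real-valued norms and the complex exponential *)

Section RealNorm.
Context {R : realType}.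

(* The norm of a normed module over R[i] takes its values in R[i]. *)
Definition rnorm {V : normedModType R[i]} (v : V) : R := complex.Re `|v|.

Section Module.
Context {V : normedModType R[i]}.
Implicit Types v w : V.

Lemma rnormE v : `|v| = (rnorm v)%:C.
Proof. by rewrite /rnorm RRe_real // ger0_real. Qed.

Lemma rnorm_ge0 v : 0 <= rnorm v.
Proof. by rewrite -ler0c -rnormE. Qed.

Lemma rnorm0 : rnorm (0 : V) = 0.
Proof. by rewrite /rnorm normr0. Qed.

Lemma rnorm0_eq0 v : rnorm v = 0 -> v = 0.
Proof. by move=> v0; apply/normr0_eq0; rewrite rnormE v0. Qed.

Lemma rnormD v w : rnorm (v + w) <= rnorm v + rnorm w.
Proof. by rewrite -lecR rmorphD /= -!rnormE ler_normD. Qed.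

Lemma rnormN v : rnorm (- v) = rnorm v.
Proof. by rewrite /rnorm normrN. Qed.

Lemma rnormB v w : rnorm (v - w) = rnorm (w - v).
Proof. by rewrite /rnorm distrC. Qed.

Lemma ler_rnormB v w u : rnorm (v - w) <= rnorm (v - u) + rnorm (u - w).
Proof. by have := rnormD (v - u) (u - w); rewrite addrA subrK. Qed.

Lemma rnormZ (c : R[i]) v : rnorm (c *: v) = rnorm c * rnorm v.
Proof. by apply: complexI; rewrite rmorphM /= -!rnormE normrZ. Qed.

Lemma ltr_rnorm v (e : R) : (`|v| < e%:C) = (rnorm v < e).
Proof. by rewrite rnormE ltcR. Qed.

End Module.

Implicit Types z w : R[i].

Lemma rnormM z w : rnorm (z * w) = rnorm z * rnorm w.
Proof. by apply: complexI; rewrite rmorphM /= -!rnormE normrM. Qed.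

Lemma rnormV z : rnorm z^-1 = (rnorm z)^-1.
Proof. by apply: complexI; rewrite fmorphV /= -!rnormE normfV. Qed.

Lemma rnorm_sqr z : rnorm z ^+ 2 = complex.Re z ^+ 2 + complex.Im z ^+ 2.
Proof. by apply: complexI; rewrite add_Re2_Im2 rmorphXn /= -rnormE. Qed.

Lemma rnorm_real (x : R) : rnorm x%:C = `|x|.
Proof.
apply/eqP; rewrite -(@eqrXn2 _ 2) ?rnorm_ge0 //= rnorm_sqr /=.
by rewrite expr0n /= addr0 real_normK // num_real.
Qed.

Lemma Re_le_rnorm z : `|complex.Re z| <= rnorm z.
Proof.
rewrite -ler_sqr ?nnegrE ?rnorm_ge0 // rnorm_sqr real_normK ?num_real //.
by rewrite lerDl sqr_ge0.
Qed.

Lemma Im_le_rnorm z : `|complex.Im z| <= rnorm z.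
Proof.
rewrite -ler_sqr ?nnegrE ?rnorm_ge0 // rnorm_sqr real_normK ?num_real //.
by rewrite lerDr sqr_ge0.
Qed.

Lemma rnorm_le_ReIm z : rnorm z <= `|complex.Re z| + `|complex.Im z|.
Proof.
rewrite -ler_sqr ?nnegrE ?rnorm_ge0 ?addr_ge0 // rnorm_sqr sqrrD.
by rewrite !real_normK ?num_real // lerD2r lerDl mulrn_wge0 // mulr_ge0.
Qed.

Lemma lt0c (e : R[i]) : 0 < e -> exists2 d : R, 0 < d & e = d%:C.
Proof.
move=> e0; exists (complex.Re e); last by rewrite RRe_real // ger0_real // ltW.
by have := e0; rewrite ltcE => /andP[].
Qed.

(** Balls of a normed module over [R[i]] have radii in [R[i]]; positive elements being real, real
    radii suffice. *)
Lemma nbhs_rnormP {V : normedModType R[i]} (v : V) (A : set V) :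
  nbhs v A <-> exists2 d : R, 0 < d & forall w : V, rnorm (w - v) < d -> A w.
Proof.
split => [/nbhs_ballP[e /= /lt0c[d d0 ->] eA]|[d d0 dA]].
  exists d => // w wd; apply: eA.
  by rewrite -ball_normE /= distrC ltr_rnorm.
apply/nbhs_ballP; exists d%:C => /=; first by rewrite ltcR.
by move=> w; rewrite -ball_normE /= distrC ltr_rnorm; exact: dA.
Qed.

(** Over [R[i]], the derivative in the direction 1 is the complex derivative; here it becomes a
    first-order expansion with a real error. *)
Lemma derivable_approx {V : normedModType R[i]} (f : R[i] -> V) z (e : R) :
  derivable f z 1 -> 0 < e -> exists2 d : R, 0 < d & forall h, rnorm h < d ->
    rnorm (f (h + z) - f z - h *: 'D_1 f z) <= e * rnorm h.
Proof.
move=> df e0.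
have /cvgrPdist_le /(_ e%:C) := df; rewrite ltcR => /(_ e0).
rewrite near_withinE => /nbhs_rnormP[d d0 dP]; exists d => // h hd.
have [->|h0] := eqVneq h 0.
  by rewrite scale0r add0r !subrr !rnorm0 mulr0.
have := dP h; rewrite subr0 => /(_ hd h0).
rewrite -/(derive f z 1) rnormE lecR [h *: 1]mulr1 => H.
have -> : f (h + z) - f z - h *: 'D_1 f z =
  (- h) *: ('D_1 f z - h^-1 *: (f (h + z) - f z)).
  by rewrite scaleNr scalerBr scalerA divff // scale1r opprB.
by rewrite rnormZ rnormN mulrC ler_wpM2r ?rnorm_ge0.
Qed.

Lemma approx_is_derive {V : normedModType R[i]} (f : R[i] -> V) z (v : V) :
  (forall e : R, 0 < e -> exists2 d : R, 0 < d & forall h, rnorm h < d ->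
    rnorm (f (h + z) - f z - h *: v) <= e * rnorm h) ->
  is_derive z 1 f v.
Proof.
move=> fv.
have cv : h^-1 *: ((f \o shift z) (h *: 1) - f z) @[h --> 0^'] --> v.
  apply/cvgrPdist_le => _ /lt0c[e e0 ->].
  have [d d0 dP] := fv e e0.
  rewrite near_withinE; apply/nbhs_rnormP; exists d => // h.
  rewrite subr0 => hd h0; rewrite /= [h *: 1]mulr1 rnormE lecR.
  have -> : v - h^-1 *: (f (h + z) - f z) =
      (- h^-1) *: (f (h + z) - f z - h *: v).
    by rewrite scaleNr [h^-1 *: (_ - h *: v)]scalerBr scalerA mulVf // scale1r opprB.
  rewrite rnormZ rnormN rnormV mulrC ler_pdivrMr; first exact: dP.
  rewrite lt_neqAle rnorm_ge0 andbT eq_sym; apply: contra_neq h0.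
  exact: rnorm0_eq0.
by split; [apply/cvg_ex; exists v | exact: cvg_lim].
Qed.

End RealNorm.

(** * The complex exponential and its derivative *)

Section ComplexExponential.
Context {R : realType}.
Implicit Types z w : R[i].

Definition cexp z : R[i] :=
  let: x +i* y := z in (expR x * cos y) +i* (expR x * sin y).

Lemma cexp0 : cexp 0 = 1.
Proof. by rewrite /cexp /= expR0 cos0 sin0 mulr1 mulr0. Qed.

Lemma cexpD z w : cexp (z + w) = cexp z * cexp w.
Proof.
case: z w => [x y] [x' y']; apply/eqP; rewrite eq_complex /= expRD cosD sinD.
by apply/andP; split; apply/eqP; ring.
Qed.

Lemma cexpN z : cexp (- z) * cexp z = 1.
Proof. by rewrite -cexpD addNr cexp0. Qed.

Lemma rnorm_cexp z : rnorm (cexp z) = expR (complex.Re z).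
Proof.
case: z => x y; apply/eqP; rewrite -(@eqrXn2 _ 2) ?rnorm_ge0 ?expR_ge0 //=.
by rewrite rnorm_sqr /= !exprMn -mulrDr cos2Dsin2 mulr1.
Qed.

Lemma cexp_periodic z : cexp (z + 0 +i* (2 * pi)) = cexp z.
Proof.
rewrite cexpD {2}/cexp expR0 mul1r mul1r mulr_natl cos2pi sin2pi; exact: mulr1.
Qed.

Lemma real_approx0 (f : R -> R) (v e : R) :
  is_derive (0 : R) (1 : R) f v -> 0 < e ->
  exists2 d, 0 < d & forall h, `|h| < d -> `|f h - f 0 - h * v| <= e * `|h|.
Proof.
move=> [df dfv] e0.
have /cvgrPdist_le /(_ e e0) := df.
rewrite near_withinE => -[d /= d0 dP]; exists d => // h hd.
have [->|h0] := eqVneq h 0; first by rewrite !subrr mul0r subrr normr0 mulr0.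
have := dP h; rewrite /= sub0r normrN => /(_ hd h0).
rewrite -/(derive f 0 1) dfv addr0 [h *: 1]mulr1 => H.
have -> : f h - f 0 - h * v = (- h) * (v - h^-1 *: (f h - f 0)).
  by rewrite /GRing.scale /=; field.
by rewrite normrM normrN mulrC ler_wpM2r.
Qed.

Lemma cexp_approx0 (e : R) : 0 < e -> exists2 d, 0 < d &
  forall h, rnorm h < d -> rnorm (cexp h - 1 - h) <= e * rnorm h.
Proof.
(* With [r = rnorm h < e'], the real part of the error is at most [4 * e' * r] and the imaginary
   part at most [5 * e' * r], whence the 10. *)
move=> e0; pose e' := Num.min (e / 10) 1.
have e'0 : 0 < e' by rewrite lt_min divr_gt0 /=.
have e'e : e' <= e / 10 by rewrite ge_min lexx.
have e'1 : e' <= 1 by rewrite ge_min lexx orbT.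
have := is_derive_expR (0 : R); rewrite expR0 => dexp.
have := is_derive_cos (0 : R); rewrite sin0 oppr0 => dcos.
have := is_derive_sin (0 : R); rewrite cos0 => dsin.
have [d1 d10 H1] := real_approx0 dexp e'0.
have [d2 d20 H2] := real_approx0 dcos e'0.
have [d3 d30 H3] := real_approx0 dsin e'0.
exists (Num.min (Num.min d1 d2) (Num.min d3 e')).
  by rewrite lt_min (lt_min 0 d1) (lt_min 0 d3) d10 d20 d30.
move=> [x y]; rewrite lt_min (lt_min _ d1) (lt_min _ d3).
move=> /andP[/andP[h1 h2] /andP[h3 h4]].
have := Re_le_rnorm (x +i* y); have := Im_le_rnorm (x +i* y).
move: (rnorm _) h1 h2 h3 h4 => r h1 h2 h3 h4 /= yr xr.
have {}H1 := H1 x (le_lt_trans xr h1).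
have {}H2 := H2 y (le_lt_trans yr h2).
have {}H3 := H3 y (le_lt_trans yr h3).
rewrite expR0 mulr1 in H1; rewrite cos0 mulr0 subr0 in H2.
rewrite sin0 mulr1 subr0 in H3.
have r0 : 0 <= r by apply: le_trans xr.
apply: (le_trans (rnorm_le_ReIm _)) => /=.
have exr : `|expR x - 1 - x| <= e' * r by apply: le_trans H1 _; rewrite ler_pM2l.
have cyr : `|cos y - 1| <= e' * r by apply: le_trans H2 _; rewrite ler_pM2l.
have syr : `|sin y - y| <= e' * r by apply: le_trans H3 _; rewrite ler_pM2l.
have rr : e' * r <= r by rewrite ler_piMl.
have r1 : r <= 1 by lra.
have rr' : r * r <= e' * r by apply: ler_wpM2r => //; exact: ltW.
have ex3 : `|expR x| <= 3.
  move: exr xr => /ler_normlP[? ?] /ler_normlP[? ?].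
  by apply/ler_normlP; split; lra.
have ex1 : `|expR x - 1| <= 2 * r.
  move: exr xr => /ler_normlP[? ?] /ler_normlP[? ?].
  by apply/ler_normlP; split; lra.
have -> : expR x * cos y - 1 - x = (expR x - 1 - x) + expR x * (cos y - 1) by ring.
have -> : expR x * sin y - 0 - y = expR x * (sin y - y) + (expR x - 1) * y by ring.
have := ler_normD (expR x - 1 - x) (expR x * (cos y - 1)).
have := ler_normD (expR x * (sin y - y)) ((expR x - 1) * y).
rewrite !normrM.
have : `|expR x| * `|cos y - 1| <= 3 * (e' * r) by apply: ler_pM.
have : `|expR x| * `|sin y - y| <= 3 * (e' * r) by apply: ler_pM.
have : `|expR x - 1| * `|y| <= 2 * r * r by apply: ler_pM.
have : 0 <= e * r by rewrite mulr_ge0 // ltW.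
have : e' * r <= e / 10 * r by rewrite ler_wpM2r.
lra.
Qed.

Lemma is_derive_cexp z : is_derive z 1 cexp (cexp z).
Proof.
apply: approx_is_derive => e e0.
have z0 : 0 < rnorm (cexp z) by rewrite rnorm_cexp expR_gt0.
have [d d0 dP] := cexp_approx0 (divr_gt0 e0 z0).
exists d => // h /dP.
have -> : cexp (h + z) - cexp z - h *: cexp z = cexp z * (cexp h - 1 - h).
  by rewrite cexpD [h *: _]mulrC; ring.
by rewrite rnormM mulrAC ler_pdivlMr // mulrC.
Qed.

End ComplexExponential.

(** * Cauchy's estimate *)

Section CauchyEstimate.
Context {R : realType}.

(** Differentiability is obtained in the open interval, so applications to a closed interval start
    from a larger one. *)
Lemma exists_antiderivative (f : R -> R) (a b : R) : a < b ->
  (forall x, a <= x <= b -> {for x, continuous f}) ->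
  exists F : R -> R, forall x, a < x < b -> is_derive x 1 F (f x).
Proof.
move=> ab fc; pose mu := @lebesgue_measure R.
have fi : mu.-integrable `[a, b] (EFin \o f).
  apply: continuous_compact_integrable; first exact: segment_compact.
  by apply: continuous_in_subspaceT => x /[!inE] /=; rewrite in_itv; exact: fc.
exists (fun x => (\int[mu]_(t in [set` `[a, x]]) f t)%R) => x /andP[ax xb].
have fx : {for x, continuous f} by apply: fc; rewrite !ltW.
have [df f'] := continuous_FTC1_closed xb fi ax fx.
by split; [exact: df | rewrite -derive1E; exact: f'].
Qed.

Section Strip.
Variable Psi : R[i] -> R[i].

Let U x y := complex.Re (Psi (x +i* y)).
Let V x y := complex.Im (Psi (x +i* y)).

(** The Cauchy-Riemann equations: the derivative [p + i q] gives [U] the gradient [(p, - q)] and [V]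
    the gradient [(q, p)]. *)
Lemma strip_approx (x0 y0 e : R) : derivable Psi (x0 +i* y0) 1 -> 0 < e ->
  let d := 'D_1 Psi (x0 +i* y0) in
  let p := complex.Re d in let q := complex.Im d in
  exists2 r : R, 0 < r & forall x y, `|x - x0| < r -> `|y - y0| < r ->
    `|U x y - (U x0 y0 + p * (x - x0) + - q * (y - y0))|
      <= e * (`|x - x0| + `|y - y0|) /\
    `|V x y - (V x0 y0 + q * (x - x0) + p * (y - y0))|
      <= e * (`|x - x0| + `|y - y0|).
Proof.
move=> dPsi e0 d p q; have [r r0 rP] := derivable_approx dPsi e0.
exists (r / 2); first by rewrite divr_gt0.
move=> x y xr yr; pose h : R[i] := (x - x0) +i* (y - y0).
have hr : rnorm h <= `|x - x0| + `|y - y0| := rnorm_le_ReIm h.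
have /rP : rnorm h < r by lra.
have -> : h + x0 +i* y0 = x +i* y.
  by apply/eqP; rewrite eq_complex /=; apply/andP; split; apply/eqP; ring.
move=> H; have {}H := le_trans H (ler_wpM2l (ltW e0) hr).
move: (le_trans (Re_le_rnorm _) H) (le_trans (Im_le_rnorm _) H).
rewrite -/d /U /V {}/p {}/q.
move: d (Psi (x +i* y)) (Psi (x0 +i* y0)) => [d1 d2] [u v] [u0 v0] /= Hu Hv.
split; [apply: le_trans Hu | apply: le_trans Hv]; rewrite le_eqVlt;
  apply/orP; left; apply/eqP; congr (`| _ |); ring.
Qed.

Lemma strip_continuous (x0 y0 : R) : derivable Psi (x0 +i* y0) 1 ->
  [/\ {for y0, continuous (U x0)}, {for x0, continuous (V ^~ y0)} &
      {for x0, continuous (U ^~ y0)}].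
Proof.
move=> dPsi; have [r r0 rP] := strip_approx dPsi (@ltr01 R).
move: rP; set p := complex.Re _; set q := complex.Im _ => rP.
have key (f : R -> R) (z K : R) :
    (forall t, `|t - z| < r -> `|f t - f z| <= K * `|t - z|) ->
    {for z, continuous f}.
  move=> fK; apply/cvgrPdist_lt => e e0.
  have K0 : 0 < `|K| + 1 by rewrite ltr_wpDl.
  exists (Num.min r (e / (`|K| + 1))) => /=.
    by rewrite lt_min r0 divr_gt0.
  move=> t /=; rewrite lt_min distrC => /andP[tr te].
  rewrite distrC; apply: (le_lt_trans (fK t tr)).
  rewrite ltr_pdivlMr // in te; apply: le_lt_trans te.
  have := normr_ge0 (t - z); have := ler_norm K; nra.
have zero_r (z : R) : `|z - z| < r by rewrite subrr normr0.
split.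
- apply: (key (U x0) y0 (`|q| + 1)) => t tr.
  have [+ _] := rP x0 t (zero_r x0) tr.
  rewrite !subrr normr0 mulr0 addr0 add0r mul1r => H.
  have -> : U x0 t - U x0 y0 =
    (U x0 t - (U x0 y0 + - q * (t - y0))) + (- q) * (t - y0) by ring.
  by apply: le_trans (ler_normD _ _) _; rewrite normrM normrN; lra.
- apply: (key (V ^~ y0) x0 (`|q| + 1)) => t tr.
  have [_] := rP t y0 tr (zero_r y0).
  rewrite !subrr normr0 mulr0 !addr0 mul1r => H.
  have -> : V t y0 - V x0 y0 =
    (V t y0 - (V x0 y0 + q * (t - x0))) + q * (t - x0) by ring.
  by apply: le_trans (ler_normD _ _) _; rewrite normrM; lra.
- apply: (key (U ^~ y0) x0 (`|p| + 1)) => t tr.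
  have [+ _] := rP t y0 tr (zero_r y0).
  rewrite !subrr normr0 mulr0 !addr0 mul1r => H.
  have -> : U t y0 - U x0 y0 =
    (U t y0 - (U x0 y0 + p * (t - x0))) + p * (t - x0) by ring.
  by apply: le_trans (ler_normD _ _) _; rewrite normrM; lra.
Qed.

Hypothesis dPsi : forall z, complex.Re z < 0 -> derivable Psi z 1.
Variable T : R.
Hypothesis T0 : 0 < T.
Hypothesis Psi_periodic : forall x, Psi (x +i* T) = Psi (x +i* 0).

(* The integral of [Psi] along the vertical period [x + i[0, T]] does not depend
   on [x]; [Q x] is an antiderivative of the integrand. *)
Lemma vertical_integral_const : exists Q : R -> R -> R,
  (forall x y, x < 0 -> 0 <= y <= T -> is_derive y 1 (Q x) (U x y)) /\
  (forall a b, a <= b -> b < 0 -> Q b T - Q b 0 = Q a T - Q a 0).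
Proof.
have [Q QP] : {Q : R -> R -> R & forall x, x < 0 ->
    forall y, 0 <= y <= T -> is_derive y 1 (Q x) (U x y)}.
  apply: (@choice R (R -> R) (fun x Qx => x < 0 -> forall y, 0 <= y <= T ->
    is_derive y 1 Qx (U x y))) => x.
  (* [0] is a placeholder for [x >= 0], where nothing is claimed. *)
  have [x0|_] := ltP x 0; last by exists 0.
  have [] := @exists_antiderivative (U x) (- 1) (T + 1).
  - by have := T0; lra.
  - by move=> y _; have [] := strip_continuous (@dPsi (x +i* y) x0).
  by move=> F FP; exists F => _ y /andP[? ?]; apply: FP; lra.
exists Q; split => [x y x0|a b ab b0]; first exact: QP.
have [P PP] : {P : R -> R -> R & forall y x, a <= x <= b ->
    is_derive x 1 (P y) (V x y)}.
  apply: (@choice R (R -> R) (fun y Py => forall x, a <= x <= b ->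
    is_derive x 1 Py (V x y))) => y.
  (* As [b < 0], the end [b / 2] lies beyond [b] and still in the left half-plane. *)
  have [] := @exists_antiderivative (V ^~ y) (a - 1) (b / 2).
  - by lra.
  - move=> x /andP[_ xb]; have x0 : x < 0 by lra.
    by have [] := strip_continuous (@dPsi (x +i* y) x0).
  by move=> F FP; exists F => x /andP[? ?]; apply: FP; lra.
have rect0 : rect_int (fun x y => P y x) Q a 0 (b - a) T = 0.
  (* [V dx + U dy] is the imaginary part of [Psi dz]; it is closed because dV/dy = dU/dx. *)
  apply: (@goursat _ _ _ V U); rewrite ?subr_ge0 ?(ltW T0) //.
  - by move=> x y [/andP[ax xb] _]; apply: PP; lra.
  - by move=> x y [/andP[ax xb] /andP[y0 yT]]; apply: QP; lra.
  move=> x0 y0 [/andP[ax xb] _].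
  have x00 : x0 < 0 by lra.
  have dx0 := @dPsi (x0 +i* y0) x00.
  exists (complex.Im ('D_1 Psi (x0 +i* y0))), (complex.Re ('D_1 Psi (x0 +i* y0))),
    (- complex.Im ('D_1 Psi (x0 +i* y0))) => e e0.
  have [r r0 rP] := strip_approx dx0 e0; exists r => // x y _ xr yr.
  by have [] := rP x y xr yr.
(* By periodicity [P T] and [P 0] are antiderivatives of the same function, so the horizontal sides
   cancel. *)
have P0T : P T b - P T a = P 0 b - P 0 a.
  apply/eqP; rewrite -subr_eq0 -normr_le0.
  have -> : P T b - P T a - (P 0 b - P 0 a) =
    (P T b - P 0 b) - (P T a - P 0 a) by ring.
  rewrite -[X in _ <= X](mul0r (b - a)).
  apply: (@mvt_bound R (fun x => P T x - P 0 x) (fun x => V x T - V x 0) a b 0) => //.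
    move=> x ax; have := PP T x ax; have := PP 0 x ax => d0 dT.
    exact: is_deriveB.
  by move=> x _; rewrite /V Psi_periodic subrr normr0.
move: rect0; rewrite /rect_int !add0r addrC.
have -> : a + (b - a) = b by ring.
rewrite P0T; lra.
Qed.

End Strip.

(* Cauchy's estimate, by comparing the mean values of
   [(F (exp z) - F 0) exp (- z)] over [Re z = -1] and over [Re z = a] as [a]
   goes to -oo; the constant is irrelevant below. *)
Theorem cauchy_estimate (F : R[i] -> R[i]) :
  (forall z, rnorm z < 1 -> derivable F z 1) ->
  (forall z, rnorm z < 1 -> rnorm (F z) <= 1) ->
  complex.Re ('D_1 F 0) <= 2 * expR 1.
Proof.
move=> dF F1.
(* With [zeta = cexp z], [Psi dz] is [(F zeta - F 0) / zeta ^+ 2] times [d zeta], the Cauchy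
   integrand for the derivative at 0; subtracting [F 0] makes [Psi] tend to that derivative as
   [Re z] goes to -oo. *)
pose Psi z := (F (cexp z) - F 0) * cexp (- z).
have cexp1 z : complex.Re z < 0 -> rnorm (cexp z) < 1.
  by move=> z0; rewrite rnorm_cexp expR_lt1.
have dPsi z : complex.Re z < 0 -> derivable Psi z 1.
  move=> z0; apply: derivableM.
    apply: derivableB; last exact: derivable_cst.
    apply/derivable1_diffP/differentiable_comp.
      by apply/derivable1_diffP; have [] := is_derive_cexp z.
    exact/derivable1_diffP/dF/cexp1.
  apply/derivable1_diffP; apply: (differentiable_comp (f := -%R)) => //.
  by apply/derivable1_diffP; have [] := is_derive_cexp (- z).
have T0 : 0 < 2 * pi :> R by rewrite mulr_gt0 // pi_gt0.
have Psi_periodic x : Psi (x +i* (2 * pi)) = Psi (x +i* 0).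
  have E : x +i* (2 * pi) = x +i* 0 + 0 +i* (2 * pi) :> R[i].
    by apply/eqP; rewrite eq_complex /= addr0 add0r !eqxx.
  rewrite /Psi E cexp_periodic; congr (_ * _).
  by rewrite -[LHS]cexp_periodic opprD subrK.
have [Q [dQ Qc]] := vertical_integral_const dPsi T0 Psi_periodic.
apply/ler_addgt0Pr => e e0; set p := complex.Re _.
have rnorm00 : rnorm (0 : R[i]) < 1 by rewrite rnorm0.
have [d d0 dP] := derivable_approx (dF 0 rnorm00) e0.
(* Since [expR (1 + d^-1) > d^-1], the image circle has radius [expR a < d]; moreover [a <= -1]. *)
pose a := - (1 + d^-1).
have a1 : a <= -1 by rewrite /a lerN2 lerDl invr_ge0 ltW.
have ad : expR a < d.
  rewrite /a expRN -[ltRHS]invrK ltf_pV2 ?posrE ?expR_gt0 ?invr_gt0 //.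
  by apply: lt_le_trans (expR_ge1Dx _); rewrite addrA ltrDr.
have Ua y : `|complex.Re (Psi (a +i* y)) - p| <= e.
  have := dP (cexp (a +i* y)); rewrite rnorm_cexp => /(_ ad).
  rewrite addr0 [_ *: _]mulrC => H.
  have E : Psi (a +i* y) - 'D_1 F 0 =
      (F (cexp (a +i* y)) - F 0 - 'D_1 F 0 * cexp (a +i* y)) * cexp (- (a +i* y)).
    by rewrite mulrBl -mulrA [cexp _ * cexp (- _)]mulrC cexpN mulr1.
  have <- : complex.Re (Psi (a +i* y) - 'D_1 F 0) =
      complex.Re (Psi (a +i* y)) - p by rewrite raddfB.
  apply: le_trans (Re_le_rnorm _) _; rewrite E rnormM rnorm_cexp.
  rewrite expRN ler_pdivrMr ?expR_gt0 //.
(* Here [F] varies by at most 2 and [cexp (- z)] has modulus [expR 1]: this is the constant of the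
   estimate. *)
have U1 y : `|complex.Re (Psi (-1 +i* y))| <= 2 * expR 1.
  apply: le_trans (Re_le_rnorm _) _; rewrite rnormM rnorm_cexp /= opprK.
  rewrite ler_wpM2r ?expR_ge0 //; apply: le_trans (rnormD _ _) _.
  rewrite rnormN; have := F1 0 rnorm00.
  have : rnorm (cexp (-1 +i* y)) < 1 by apply: cexp1 => /=; lra.
  by move/F1; lra.
have Ia : `|(Q a (2 * pi) - p * (2 * pi)) - (Q a 0 - p * 0)| <= e * (2 * pi - 0).
  apply: (@mvt_bound R (fun y => Q a y - p * y)
    (fun y => complex.Re (Psi (a +i* y)) - p) 0 (2 * pi) e) => //.
  - exact: ltW.
  - move=> y y0; have := dQ a y _ y0 => dQy.
    have {}dQy := dQy (le_lt_trans a1 (ltrN10 R)).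
    by apply: is_derive_eq; rewrite /GRing.scale /=; ring.
have I1 : `|Q (-1) (2 * pi) - Q (-1) 0| <= 2 * expR 1 * (2 * pi - 0).
  apply: (@mvt_bound R (Q (-1)) (fun y => complex.Re (Psi (-1 +i* y)))
    0 (2 * pi) (2 * expR 1)) => //.
  - exact: ltW.
  - by move=> y y0; apply: dQ => //; exact: ltrN10.
have Qa := Qc a (-1) a1 (ltrN10 R).
rewrite -(ler_pM2r T0).
move: Ia I1 => /ler_normlP[? ?] /ler_normlP[? ?]; lra.
Qed.

End CauchyEstimate.

(** * The Cayley transform of a half-plane containing the domain *)

Section RowVectors.
Context {R : realType} {N : nat}.
Implicit Types (v y z : 'rV[R[i]]_N) (c : 'cV[R[i]]_N).

Lemma rnorm_lt_coordP v (d : R) :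
  rnorm v < d <-> 0 < d /\ forall j, rnorm (v ord0 j) < d.
Proof.
rewrite -ltr_rnorm -[v]subr0 -normrN opprB.
have <- : ball (0 : 'rV[R[i]]_N) d%:C v = (`|0 - v| < d%:C) :> Prop.
  by rewrite -ball_normE.
split=> [[d0 dv]|[d0 dv]]; split; rewrite ?ltcR // in d0 *.
  move=> j; have := dv ord0 j; rewrite -ball_normE /= mxE sub0r normrN.
  by rewrite ltr_rnorm subr0.
move=> i j; rewrite -ball_normE /= mxE sub0r normrN ltr_rnorm (ord1 i).
by have := dv j; rewrite subr0.
Qed.

Lemma rnorm_coord v j : rnorm (v ord0 j) <= rnorm v.
Proof.
apply/ler_addgt0Pr => e e0; apply: ltW.
have /rnorm_lt_coordP[_] : rnorm v < rnorm v + e by rewrite ltrDl.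
exact.
Qed.

(** Functionals are coefficient columns, so that [N] of them form a square matrix and independence
    means invertibility. *)
Definition linform c y : R[i] := \sum_j y ord0 j * c j ord0.

Lemma linformD c y z : linform c (y + z) = linform c y + linform c z.
Proof. by rewrite -big_split; apply: eq_bigr => j _; rewrite mxE mulrDl. Qed.

Lemma linformZ c (a : R[i]) y : linform c (a *: y) = a * linform c y.
Proof.
by rewrite /linform big_distrr; apply: eq_bigr => j _ /=; rewrite mxE mulrA.
Qed.

Lemma linformN c y : linform c (- y) = - linform c y.
Proof. by rewrite -scaleN1r linformZ mulN1r. Qed.

Lemma linformB c y z : linform c (y - z) = linform c y - linform c z.
Proof. by rewrite linformD linformN. Qed.

Lemma linform_bound c : exists2 K : R, 0 < K &
  forall y, rnorm (linform c y) <= K * rnorm y.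
Proof.
exists (1 + \sum_j rnorm (c j ord0)).
  by rewrite ltr_pwDl // sumr_ge0 // => j _; exact: rnorm_ge0.
move=> y; apply: (@le_trans _ _ (\sum_j rnorm (y ord0 j * c j ord0))).
  rewrite /linform; elim/big_ind2 : _ => [|a a' b b' aa' bb'|//].
    by rewrite rnorm0.
  by apply: le_trans (rnormD _ _) _; exact: lerD.
rewrite mulrDl mul1r mulr_suml ler_wpDl ?rnorm_ge0 //.
apply: ler_sum => j _; rewrite rnormM mulrC ler_wpM2l ?rnorm_ge0 //.
exact: rnorm_coord.
Qed.

Lemma is_derive_linform c (phi : R[i] -> 'rV[R[i]]_N) (z : R[i]) :
  derivable phi z 1 ->
  is_derive z 1 (fun t => linform c (phi t)) (linform c ('D_1 phi z)).
Proof.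
move=> dphi; have [K K0 KP] := linform_bound c.
apply: approx_is_derive => e e0.
have [d d0 dP] := derivable_approx dphi (divr_gt0 e0 K0).
exists d => // h /dP hP.
rewrite -linformB -[h *: _]linformZ -linformB.
apply: le_trans (KP _) _; rewrite mulrC -ler_pdivlMr //.
by rewrite mulrAC.
Qed.

End RowVectors.

Lemma continuousMcst {R : realType} (f : R -> R) (k t : R) :
  {for t, continuous f} -> {for t, continuous (fun s => f s * k)}.
Proof.
by move=> fc; apply: (@continuousM _ _ f (cst k) t fc); exact: cst_continuous.
Qed.

Lemma continuous_sum {R : realType} {I : Type} (r : seq I) (h : I -> R -> R)
    (t : R) : (forall i, {for t, continuous (h i)}) ->
  {for t, continuous (fun s => \sum_(i <- r) h i s)}.
Proof.
move=> hc; elim: r => [|i r IH].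
  have -> : (fun s => \sum_(i <- [::]) h i s) = cst 0.
    by apply/funext => s; rewrite big_nil.
  exact: cst_continuous.
have -> : (fun s => \sum_(j <- i :: r) h j s) =
    h i + (fun s => \sum_(j <- r) h j s).
  by apply/funext => s; rewrite big_cons.
exact: continuousD.
Qed.

Section LowerBound.
Context {R : realType} {N : nat}.
Variables (D : set 'rV[R[i]]_N) (c : 'cV[R[i]]_N) (b : R[i]).

Let W y : R[i] := linform c y + b.

Hypothesis W_gt0 : forall y, D y -> 0 < complex.Re (W y).

Variable w0 : R[i].
Hypothesis w0_gt0 : 0 < complex.Re w0.

Variable u : R[i].
Hypothesis u1 : rnorm u <= 1.

(* [Re w0 / (W + conj w0)] maps [D] into the unit disc; up to an additive
   constant it is half the Moebius map [w |-> (w0 - w) / (w + conj w0)]. *)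
Definition cayley y : R[i] := u * ((complex.Re w0)%:C * (W y + w0^*)^-1).

Definition cayley_diff y v : R[i] :=
  u * ((complex.Re w0)%:C * (- (W y + w0^*) ^- 2 * linform c v)).

Local Notation G := cayley.
Local Notation dG := cayley_diff.

Lemma Re_denominator y : D y -> complex.Re w0 < complex.Re (W y + w0^*).
Proof.
move=> /W_gt0; move: (W y) => [w1 w2]; case: (w0) => [a1 a2] /=.
by rewrite ltrDr.
Qed.

Lemma denominator_neq0 y : D y -> W y + w0^* != 0.
Proof.
move=> Dy; apply/eqP => E; have := Re_denominator Dy.
by rewrite E /= ltNge ltW.
Qed.

Lemma rnorm_cayley_le1 y : D y -> rnorm (G y) <= 1.
Proof.
move=> Dy; rewrite !rnormM -[1]mulr1 ler_pM ?mulr_ge0 ?rnorm_ge0 //.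
rewrite rnormV rnorm_real gtr0_norm // ler_pdivrMr ?mul1r.
  apply: ltW; apply: lt_le_trans (Re_denominator Dy) _.
  by apply: le_trans (Re_le_rnorm _); exact: ler_norm.
by apply: lt_le_trans (le_trans (ler_norm _) (Re_le_rnorm _));
  apply: lt_trans (Re_denominator Dy).
Qed.

Let K : R := 2 * expR 1.

(** Cauchy's estimate for [G \o phi], whose derivative at 0 is [dG z v / lam]. It puts no condition
    on [G z], so [w0] and [u] can stay fixed while [z] moves along a curve. *)
Lemma kobayashi_metric_ge z v :
  ((complex.Re (dG z v) / K)%:E <= kobayashi_metric D z v)%E.
Proof.
apply: le_ereal_inf_tmp => _ [lam [lam0 [phi [phiD phi0 phi1]]] <-].
have K0 : 0 < K by rewrite mulr_gt0 // expR_gt0.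
rewrite lee_fin ler_pdivrMr //.
have dGphi (t : R[i]) : rnorm t < 1 ->
    is_derive t (1 : R[i]) (G \o phi) (dG (phi t) ('D_1 phi t)).
  move=> t1; have [dphi Dt] : derivable phi t 1 /\ D (phi t).
    by apply: phiD; rewrite rnormE ltcR.
  have dW : is_derive t (1 : R[i]) (fun t => W (phi t) + w0^*)
      (linform c ('D_1 phi t)).
    have dl := is_derive_linform c dphi.
    have dcst := is_derive_cst (b + w0^*) t (1 : R[i]).
    have := is_deriveD dl dcst; rewrite addr0.
    congr is_derive; apply/funext => s; by rewrite /W -addrA.
  have W0 : W (phi t) + w0^* != 0 by exact: denominator_neq0.
  have dV : is_derive t (1 : R[i]) (fun t => (W (phi t) + w0^*)^-1)
      (- (W (phi t) + w0^*) ^- 2 * linform c ('D_1 phi t)).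
    split; first exact: derivableV.
    by rewrite deriveV // derive_val.
  have := is_deriveZ (u * (complex.Re w0)%:C) dV.
  have -> : (u * (complex.Re w0)%:C) \*: (fun t0 : R[i] => (W (phi t0) + w0^*)^-1)
     = G \o phi by apply/funext => s; rewrite /cayley /= mulrA.
  by move=> dd; apply: is_derive_eq; rewrite /cayley_diff mulrA.
have := @cauchy_estimate R (G \o phi).
have r00 : rnorm (0 : R[i]) < 1 by rewrite rnorm0.
have [_ ->] := dGphi 0 r00.
rewrite phi0 -derive1E phi1 => H.
have : complex.Re (dG z ((lam^-1)%:C *: v)) <= K.
  apply: H => t t1; first by have [] := dGphi t t1.
  apply: rnorm_cayley_le1; have [] := phiD t; last by [].
  by rewrite rnormE ltcR.
have -> : dG z ((lam^-1)%:C *: v) = (lam^-1)%:C * dG z v.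
  by rewrite /cayley_diff linformZ; ring.
have -> : complex.Re ((lam^-1)%:C * dG z v) = lam^-1 * complex.Re (dG z v).
  by case: (dG z v) => [a1 a2] /=; rewrite mul0r subr0.
by rewrite ler_pdivrMl.
Qed.


(** * The Cayley transform along a curve *)

Section AlongCurve.
Variable g : R -> 'rV[R[i]]_N.
Hypothesis re_g : forall j, C1_fun (re_coord g j).
Hypothesis im_g : forall j, C1_fun (im_coord g j).

Let X t := complex.Re (W (g t) + w0^*).
Let Y t := complex.Im (W (g t) + w0^*).
Let dX t := complex.Re (linform c (velocity g t)).
Let dY t := complex.Im (linform c (velocity g t)).

Lemma dXE t : dX t = \sum_j (derive1 (re_coord g j) t * complex.Re (c j ord0)
  - derive1 (im_coord g j) t * complex.Im (c j ord0)).
Proof.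
rewrite /dX /linform raddf_sum; apply: eq_bigr => j _; rewrite mxE.
by case: (c j ord0).
Qed.

Lemma dYE t : dY t = \sum_j (derive1 (re_coord g j) t * complex.Im (c j ord0)
  + derive1 (im_coord g j) t * complex.Re (c j ord0)).
Proof.
rewrite /dY /linform raddf_sum; apply: eq_bigr => j _; rewrite mxE.
by case: (c j ord0).
Qed.

Lemma is_derive_C1 (f : R -> R) (t : R) : C1_fun f ->
  is_derive t (1 : R) f (derive1 f t).
Proof. by move=> [df _]; split; [exact: df | rewrite derive1E]. Qed.

Lemma is_derive_X t : is_derive t (1 : R) X (dX t).
Proof.
have dh j : is_derive t (1 : R) (fun s => re_coord g j s * complex.Re (c j ord0)
    - im_coord g j s * complex.Im (c j ord0))
    (derive1 (re_coord g j) t * complex.Re (c j ord0)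
    - derive1 (im_coord g j) t * complex.Im (c j ord0)).
  have dre := is_derive_C1 t (re_g j); have dim := is_derive_C1 t (im_g j).
  by apply: is_derive_eq; rewrite /GRing.scale /=; ring.
have dcst := is_derive_cst (complex.Re (b + w0^*)) t (1 : R).
have := is_deriveD (is_derive_sum dh) dcst; rewrite addr0 -dXE.
have XE s : X s = complex.Re (linform c (g s)) + complex.Re (b + w0^*).
  by rewrite /X /W -[_ + b + _]addrA raddfD.
congr is_derive; apply/funext => s; rewrite XE fctE; congr (_ + _).
rewrite fct_sumE /linform [RHS]raddf_sum; apply: eq_bigr => j _.
by rewrite /re_coord /im_coord; case: (g s ord0 j); case: (c j ord0).
Qed.

Lemma is_derive_Y t : is_derive t (1 : R) Y (dY t).
Proof.
have dh j : is_derive t (1 : R) (fun s => re_coord g j s * complex.Im (c j ord0)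
    + im_coord g j s * complex.Re (c j ord0))
    (derive1 (re_coord g j) t * complex.Im (c j ord0)
    + derive1 (im_coord g j) t * complex.Re (c j ord0)).
  have dre := is_derive_C1 t (re_g j); have dim := is_derive_C1 t (im_g j).
  by apply: is_derive_eq; rewrite /GRing.scale /=; ring.
have dcst := is_derive_cst (complex.Im (b + w0^*)) t (1 : R).
have := is_deriveD (is_derive_sum dh) dcst; rewrite addr0 -dYE.
have YE s : Y s = complex.Im (linform c (g s)) + complex.Im (b + w0^*).
  by rewrite /Y /W -[_ + b + _]addrA raddfD.
congr is_derive; apply/funext => s; rewrite YE fctE; congr (_ + _).
rewrite fct_sumE /linform [RHS]raddf_sum; apply: eq_bigr => j _.
by rewrite /re_coord /im_coord; case: (g s ord0 j); case: (c j ord0).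
Qed.

Lemma continuous_dX : continuous dX.
Proof.
rewrite (funext dXE) => t.
apply: continuous_sum => j; have [_ cre] := re_g j; have [_ cim] := im_g j.
apply: (@continuousB _ _ _ (fun s => derive1 (re_coord g j) s * _)
  (fun s => derive1 (im_coord g j) s * _)); apply: continuousMcst;
  [exact: cre | exact: cim].
Qed.

Lemma continuous_dY : continuous dY.
Proof.
rewrite (funext dYE) => t.
apply: continuous_sum => j; have [_ cre] := re_g j; have [_ cim] := im_g j.
apply: (@continuousD _ _ _ (fun s => derive1 (re_coord g j) s * _)
  (fun s => derive1 (im_coord g j) s * _)); apply: continuousMcst;
  [exact: cre | exact: cim].
Qed.

Let S t := X t ^+ 2 + Y t ^+ 2.

Lemma S_neq0 t : D (g t) -> S t != 0.
Proof.
move=> Dg; rewrite gt_eqF // ltr_pwDl ?sqr_ge0 // exprn_gt0 //.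
exact: lt_trans (Re_denominator Dg).
Qed.

Let r := complex.Re w0.
Let u1' := complex.Re u.
Let u2' := complex.Im u.

(** [velocity] is defined through real and imaginary parts, so [G] along the curve is written as a
    real rational function of [X] and [Y], to which real calculus applies. *)
Lemma Re_GE t : complex.Re (G (g t)) = r * (u1' * X t + u2' * Y t) * (S t)^-1.
Proof.
rewrite /cayley /S /X /Y /u1' /u2' /r; case: (W (g t) + _) => x y.
by case: (u) => [a1 a2] /=; ring.
Qed.

Lemma Re_dGE t : D (g t) -> complex.Re (dG (g t) (velocity g t)) =
  r * ((u1' * dX t + u2' * dY t) * (S t)^-1
       - (u1' * X t + u2' * Y t) * (2 * X t * dX t + 2 * Y t * dY t) * (S t) ^- 2).
Proof.
move=> /S_neq0; rewrite /cayley_diff /S /X /Y /dX /dY /u1' /u2' /r.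
case: (W (g t) + _) => x y; case: (linform _ _) => x' y'.
case: (u) => [a1 a2] /= S0; field; rewrite S0 /=.
have -> : (x * x - y * y) ^+ 2 + (x * y + y * x) ^+ 2 = (x ^+ 2 + y ^+ 2) ^+ 2.
  by ring.
by rewrite expf_neq0.
Qed.

Lemma is_derive_Re_G t : D (g t) ->
  is_derive t (1 : R) (fun s => complex.Re (G (g s)))
    (complex.Re (dG (g t) (velocity g t))).
Proof.
move=> Dg; have S0 := S_neq0 Dg; rewrite Re_dGE //.
rewrite (funext Re_GE).
have dXt := is_derive_X t; have dYt := is_derive_Y t.
have dS : is_derive t (1 : R) S (2 * X t * dX t + 2 * Y t * dY t).
  by apply: is_derive_eq; rewrite /GRing.scale /=; ring.
have dV := is_deriveV S0 dS.
by apply: is_derive_eq; rewrite /GRing.scale /=; ring.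
Qed.

Lemma continuous_Re_dG : (forall s, 0 <= s <= 1 -> D (g s)) ->
  {within `[0, 1], continuous (fun s => complex.Re (dG (g s) (velocity g s)))}.
Proof.
move=> Dg.
(* [h] agrees with the given function on [0, 1], where [S] does not vanish. *)
pose h (s : R) := r * ((u1' * dX s + u2' * dY s) * (S s)^-1
  - (u1' * X s + u2' * Y s) * (2 * X s * dX s + 2 * Y s * dY s) * (S s) ^- 2).
apply: (@subspace_eq_continuous _ _ _ h).
  move=> s; rewrite inE /= in_itv /= => s01.
  exact/esym/Re_dGE/Dg.
apply: continuous_in_subspaceT => s; rewrite inE /= in_itv /= => s01.
have S0 := S_neq0 (Dg s s01).
have cX : X x @[x --> s] --> X s.
  apply/differentiable_continuous/derivable1_diffP.
  by have [] := is_derive_X s.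
have cY : Y x @[x --> s] --> Y s.
  apply/differentiable_continuous/derivable1_diffP.
  by have [] := is_derive_Y s.
have cdX : dX x @[x --> s] --> dX s := @continuous_dX s.
have cdY : dY x @[x --> s] --> dY s := @continuous_dY s.
have cS : S x @[x --> s] --> S s by apply: cvgD; exact: cvgM.
have ck (k : R) : k @[x --> s] --> k by exact: cvg_cst.
apply: cvgM; first exact: ck.
apply: cvgB.
  apply: cvgM; last exact: cvgV.
  apply: cvgD; apply: cvgM; [exact: ck | exact: cdX | exact: ck | exact: cdY].
apply: cvgM.
  apply: cvgM; first by apply: cvgD; apply: cvgM => //; exact: ck.
  by apply: cvgD; apply: cvgM => //; apply: cvgM => //; exact: ck.
by apply: cvgV; rewrite ?expf_neq0 //; exact: cvgM.
Qed.

End AlongCurve.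
End LowerBound.

(** * Lower bounds for the Kobayashi distance *)

Section IntegralComparison.
Context {R : realType}.
Local Open Scope ereal_scope.
Notation mu := (@lebesgue_measure R).

(* Neither function is assumed to be measurable: the integral of a nonnegative
   function is in any case the supremum over the simple functions below it. *)
Lemma le_lower_integral (A : set R) (f h : R -> \bar R) :
  (forall t, A t -> 0 <= h t) -> (forall t, A t -> f t <= h t) ->
  \int[mu]_(t in A) f t <= \int[mu]_(t in A) h t.
Proof.
move=> h0 fh; rewrite integralE.
(* The negative part of [f] can only lower its integral. *)
apply: (@le_trans _ _ (\int[mu]_(t in A) f^\+ t)).
  by apply: geeDl; rewrite oppe_le0; exact: integral_ge0.
rewrite !ge0_integralE //; apply: ereal_sup_le => _ [k kf <-].
exists k => // x; apply: le_trans (kf x) _; rewrite /patch.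
by case: ifP => // /set_mem Ax; rewrite funeposE ge_max h0 // fh.
Qed.

End IntegralComparison.

Section KobayashiMetric.
Context {R : realType} {N : nat}.
Implicit Types (D : set 'rV[R[i]]_N) (x y z v : 'rV[R[i]]_N).
Local Open Scope ereal_scope.

Lemma kobayashi_metric_ge0 D z v : 0 <= kobayashi_metric D z v.
Proof. by apply: le_ereal_inf_tmp => _ [lam [lam0 _] <-]; rewrite lee_fin ltW. Qed.

Lemma kobayashi_length_ge0 D s : 0 <= kobayashi_length D s.
Proof.
by apply: sume_ge0 => g _; apply: integral_ge0 => t _; exact: kobayashi_metric_ge0.
Qed.

Lemma kobayashi_dist_ge0 D x y : 0 <= kobayashi_dist D x y.
Proof. by apply: le_ereal_inf_tmp => _ [s _ <-]; exact: kobayashi_length_ge0. Qed.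

Section LowerBound.
Variables (D : set 'rV[R[i]]_N) (c : 'cV[R[i]]_N) (b : R[i]).
Hypothesis W_gt0 : forall y, D y -> (0 < complex.Re (linform c y + b))%R.
Variable w0 : R[i].
Hypothesis w0_gt0 : (0 < complex.Re w0)%R.
Variable u : R[i].
Hypothesis u1 : (rnorm u <= 1)%R.

Let G := cayley c b w0 u.
Let K : R := (2 * expR 1)%R.

(** The left side is the integral over [0, 1] of the derivative of [Re G / K] along [g], which
    [kobayashi_metric_ge] bounds pointwise. *)
Lemma kobayashi_arc_ge g : C1_arc D g ->
  ((complex.Re (G (g 1%R)) - complex.Re (G (g 0%R))) / K)%:E <=
  \int[@lebesgue_measure R]_(t in `[0%R, 1%R])
     kobayashi_metric D (g t) (velocity g t).
Proof.
move=> [re_g im_g Dg].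
pose f t : R := complex.Re (cayley_diff c b w0 u (g t) (velocity g t)).
have fc := continuous_Re_dG (u := u) W_gt0 w0_gt0 re_g im_g Dg.
have df (t : R) : (0 <= t <= 1)%R ->
    is_derive t (1%R : R) (fun s => complex.Re (G (g s)) / K)%R (f t / K)%R.
  move=> t01; have dGg := is_derive_Re_G W_gt0 w0_gt0 u re_g im_g (Dg t t01).
  by apply: is_derive_eq; rewrite /GRing.scale /=; ring.
have fcont (t : R) : (0 <= t <= 1)%R ->
    {for t, continuous (fun s => complex.Re (G (g s)) / K)%R}.
  move=> t01; apply/differentiable_continuous/derivable1_diffP.
  by have [] := df t t01.
rewrite mulrBl EFinB -(@continuous_FTC2 _ (fun t => f t / K)%R
    (fun s => complex.Re (G (g s)) / K)%R) //.
- apply: le_lower_integral => t; first by move=> _; exact: kobayashi_metric_ge0.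
  by move=> _; exact: kobayashi_metric_ge.
- move=> t; apply: cvgM; [exact: fc | exact: cvg_cst].
- split=> [t||].
  + rewrite in_itv /= => /andP[t0 t1].
    have t01 : (0 <= t <= 1)%R by rewrite !ltW.
    by have [] := df t t01.
  + apply: cvg_at_right_filter; apply: fcont; lra.
  + apply: cvg_at_left_filter; apply: fcont; lra.
- move=> t; rewrite in_itv /= => /andP[t0 t1]; rewrite derive1E.
  have t01 : (0 <= t <= 1)%R by rewrite !ltW.
  by have [_] := df t t01.
Qed.

Lemma kobayashi_length_ge s x y : curve D x y s ->
  ((complex.Re (G y) - complex.Re (G x)) / K)%:E <= kobayashi_length D s.
Proof.
elim: s x => [|g s IH] x /= => [->|[gD <- /IH]].
  by rewrite subrr mul0r; exact: kobayashi_length_ge0.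
rewrite /kobayashi_length big_cons => IHs.
apply: le_trans (leeD (kobayashi_arc_ge gD) IHs).
by rewrite -EFinD lee_fin le_eqVlt; apply/orP; left; apply/eqP; ring.
Qed.

Lemma kobayashi_dist_ge x y :
  ((complex.Re (G y) - complex.Re (G x)) / K)%:E <= kobayashi_dist D x y.
Proof.
by apply: le_ereal_inf_tmp => _ [s cs <-]; exact: kobayashi_length_ge.
Qed.

End LowerBound.

(** With the Cayley transform centred at [W x], its value at [x] is [u / 2] and its increment from
    [x] to [y] is [u * h], where [2 * rnorm h] is the pseudo-hyperbolic distance. This doubles the
    constant [2 * expR 1]. *)
Lemma kobayashi_dist_pseudohyperbolic D (c : 'cV[R[i]]_N) (b : R[i]) x y (e : R) :
  let W z : R[i] := (linform c z + b)%R in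
  (forall z, D z -> (0 < complex.Re (W z))%R) -> D x -> D y ->
  kobayashi_dist D x y < e%:E ->
  (rnorm (W y - W x) <= 4 * expR 1 * e * rnorm (W y + (W x)^*))%R.
Proof.
move=> W W_gt0 Dx Dy xye.
pose w0 := W x; have w0_gt0 : (0 < complex.Re w0)%R := W_gt0 x Dx.
pose h : R[i] := ((complex.Re w0)%:C * (W y + w0^*)^-1 - 2^-1)%R.
have W0 := denominator_neq0 W_gt0 w0_gt0 Dy.
have W0' := denominator_neq0 W_gt0 w0_gt0 Dx.
have rE : (2 * (complex.Re w0)%:C = W x + w0^*)%R by rewrite -addcJ.
have hE : h = ((W x - W y) / (2 * (W y + w0^*)))%R.
  have -> : (W x - W y = 2 * (complex.Re w0)%:C - (W y + w0^*))%R by rewrite rE; ring.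
  by rewrite /h; field.
have Q0 : (0 < rnorm (W y + w0^*))%R.
  rewrite lt_neqAle rnorm_ge0 andbT eq_sym; apply: contra_neq W0.
  exact: rnorm0_eq0.
have rh : (rnorm h = rnorm (W y - W x) / (2 * rnorm (W y + w0^*)))%R.
  rewrite hE rnormM rnormV rnormM rnormB.
  have -> : rnorm (2%R : R[i]) = 2%R :> R.
    by rewrite -[2%R in LHS](rmorph_nat (real_complex R)) rnorm_real ger0_norm.
  by [].
have [h0|hn0] := eqVneq h 0%R.
  have -> : (W y - W x = 0)%R.
    apply: rnorm0_eq0; move: rh; rewrite h0 rnorm0 => /esym/eqP.
    rewrite mulf_eq0 invr_eq0 mulf_eq0 (gt_eqF Q0) orbF pnatr_eq0 orbF.
    by move/eqP.
  rewrite rnorm0 !mulr_ge0 ?rnorm_ge0 ?expR_ge0 //.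
  by rewrite -lee_fin ltW // (le_lt_trans _ xye) // kobayashi_dist_ge0.
(* [u] turns [h] onto the positive real axis, so passing to real parts loses nothing. *)
pose u : R[i] := (h^* / (rnorm h)%:C)%R.
have h0 : (0 < rnorm h)%R.
  rewrite lt_neqAle rnorm_ge0 andbT eq_sym; apply: contra_neq hn0.
  exact: rnorm0_eq0.
have u1 : (rnorm u <= 1)%R.
  rewrite rnormM rnormV rnorm_real ger0_norm ?rnorm_ge0 //.
  have -> : rnorm h^* = rnorm h by rewrite /rnorm normcJ.
  by rewrite divff // gt_eqF.
have := kobayashi_dist_ge W_gt0 w0_gt0 u1 x y.
have -> : (complex.Re (cayley c b w0 u y) - complex.Re (cayley c b w0 u x)
    = rnorm h)%R.
  have -> : cayley c b w0 u x = (u * 2^-1)%R.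
    rewrite /cayley -/(W x) -rE; congr (_ * _)%R; field.
    by rewrite fmorph_eq0 gt_eqF.
  have -> : cayley c b w0 u y = (u * (h + 2^-1))%R.
    by rewrite /cayley -/(W y) /h subrK.
  rewrite -raddfB -mulrBr addrK /u mulrAC [(_ * h)%R]mulrC -sqr_normc.
  rewrite rnormE -rmorphXn -fmorphV -rmorphM /= expr2 mulfK //.
  by rewrite gt_eqF.
move=> /le_lt_trans/(_ xye); rewrite lte_fin ltr_pdivrMr ?mulr_gt0 ?expR_gt0 //.
rewrite rh ltr_pdivrMr ?mulr_gt0 // => /ltW/le_trans; apply.
by rewrite le_eqVlt; apply/orP; left; apply/eqP; ring.
Qed.

End KobayashiMetric.

(** * Upper bounds for the Kobayashi metric *)

Section Reflection.
Context {R : realType}.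
Local Open Scope ereal_scope.
Notation mu := (@lebesgue_measure R).

Import HBNNSimple.

Let refl : measurableTypeR R -> measurableTypeR R := fun t => (1 - t)%R.

Let measurable_refl : measurable_fun setT refl.
Proof.
apply: continuous_measurable_fun => t.
by apply: cvgB; [exact: cvg_cst | exact: cvg_id].
Qed.

Lemma lebesgue_measure_onem (A : set R) : measurable A ->
  pushforward mu refl A = mu A.
Proof.
move=> mA; apply/esym/lebesgue_measure_unique => //= _ [[a b]] _ <-.
rewrite /pushforward.
have -> : refl @^-1` `]a, b] = `[(1 - b)%R, (1 - a)%R[%classic.
  apply/seteqP; split => t; rewrite /refl /= !in_itv /= => /andP[? ?];
    apply/andP; split; lra.
rewrite !lebesgue_measure_itv/= !lte_fin ltrD2l ltrN2.
by case: ifP => // _; rewrite -!EFinB; congr EFin; ring.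
Qed.

(** Serves to reverse curves. The change of variable is carried out on the simple functions below
    [h], which are measurable. *)
Lemma lower_integral_onem (h : R -> \bar R) : (forall t, 0 <= h t) ->
  \int[mu]_(t in `[0%R, 1%R]) h (1 - t)%R <= \int[mu]_(t in `[0%R, 1%R]) h t.
Proof.
move=> h0; rewrite ge0_integralE //.
apply: ge_ereal_sup => _ [k /= kh <-]; rewrite -integralT_nnsfun.
have -> : \int[mu]_x (k x)%:E = \int[mu]_x (k (1 - x)%R)%:E.
  transitivity (\int[pushforward mu refl]_x (k x)%:E).
    apply: eq_measure_integral => A mA _; exact/esym/lebesgue_measure_onem.
  rewrite ge0_integral_pushforward ?preimage_setT //.
  - exact/measurable_EFinP.
  - by move=> y _; rewrite lee_fin.
rewrite [X in _ <= X]integral_mkcond.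
apply: le_lower_integral => t _; first by rewrite /patch; case: ifP.
apply: le_trans (kh _) _; rewrite /patch /=.
case: ifPn => [|_]; last by case: ifP.
rewrite inE /= in_itv /= => /andP[? ?]; rewrite mem_set.
  by rewrite opprB addrC subrK.
by rewrite /= in_itv /=; apply/andP; split; lra.
Qed.

End Reflection.

Section KobayashiDistance.
Context {R : realType} {N : nat}.
Implicit Types (D : set 'rV[R[i]]_N) (x y z v : 'rV[R[i]]_N).
Implicit Types (g : R -> 'rV[R[i]]_N).

Lemma is_derive_affine z v (t : R[i]) :
  is_derive t (1 : R[i]) (fun s : R[i] => z + s *: v) v.
Proof.
apply: approx_is_derive => e e0; exists 1 => // h _.
rewrite [X in rnorm X](_ : _ = 0) ?rnorm0 ?mulr_ge0 ?rnorm_ge0 ?(ltW e0) //.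
by rewrite scalerDl opprD addrACA subrr add0r addrK subrr.
Qed.

Lemma is_derive_reflect (phi : R[i] -> 'rV[R[i]]_N) (t : R[i]) :
  derivable phi (- t) 1 ->
  is_derive t (1 : R[i]) (fun s => phi (- s)) (- 'D_1 phi (- t)).
Proof.
move=> dphi; apply: approx_is_derive => e e0.
have [d d0 dP] := derivable_approx dphi e0; exists d => // h hd.
have := dP (- h); rewrite rnormN => /(_ hd).
by rewrite opprD scaleNr scalerN.
Qed.

Local Open Scope ereal_scope.

Lemma kobayashi_metric_le_affine D z v (lam : R) : (0 < lam)%R ->
  (forall t : R[i], (rnorm t < 1)%R -> D (z + t *: ((lam^-1)%:C *: v))%R) ->
  kobayashi_metric D z v <= lam%:E.
Proof.
move=> lam0 zD; apply: ereal_inf_lbound; exists lam => //; split => //.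
exists (fun t => z + t *: ((lam^-1)%:C *: v))%R; split.
- move=> t; rewrite rnormE ltcR => t1; split; last exact: zD.
  by have [] := is_derive_affine z ((lam^-1)%:C *: v) t.
- by rewrite scale0r addr0.
- by rewrite derive1E; have [_] := is_derive_affine z ((lam^-1)%:C *: v) (0 : R[i])%R.
Qed.

Lemma kobayashi_metric_ball D z v (r : R) : (0 < r)%R ->
  (forall y, (rnorm (y - z) < r)%R -> D y) ->
  kobayashi_metric D z v <= (rnorm v / r)%:E.
Proof.
(* The slack [e] keeps [lam] positive when [v = 0]. *)
move=> r0 rD; apply/lee_addgt0Pr => e e0.
have lam0 : (0 < rnorm v / r + e)%R by rewrite ltr_wpDl // divr_ge0 ?rnorm_ge0 ?ltW.
apply: kobayashi_metric_le_affine => // t t1.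
apply: rD; rewrite addrAC subrr add0r !rnormZ rnorm_real.
rewrite ger0_norm ?invr_ge0 ?(ltW lam0) //.
have vr : ((rnorm v / r + e)^-1 * rnorm v < r)%R.
  rewrite ltr_pdivrMl // mulrDl divfK ?gt_eqF // ltrDl mulr_gt0 //.
apply: le_lt_trans vr; rewrite ler_piMl ?(ltW t1) //.
by rewrite mulr_ge0 ?rnorm_ge0 ?invr_ge0 ?(ltW lam0).
Qed.

Lemma kobayashi_metric_line D z v :
  (forall t : R[i], D (z + t *: v)%R) -> kobayashi_metric D z v = 0.
Proof.
move=> zD; apply/eqP; rewrite eq_le kobayashi_metric_ge0 andbT.
apply/lee_addgt0Pr => e e0; rewrite add0e.
by apply: kobayashi_metric_le_affine => // t _; rewrite scalerA.
Qed.

Lemma kobayashi_metricN_le D z v :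
  kobayashi_metric D z (- v) <= kobayashi_metric D z v.
Proof.
apply: le_ereal_inf_tmp => _ [lam [lam0 [phi [phiD phi0 phi1]]] <-].
apply: ereal_inf_lbound; exists lam => //; split => //.
exists (fun t => phi (- t)%R); split.
- move=> t t1; have t1' : (`|- t| < 1)%R by rewrite normrN.
  have [dphi Dphi] := phiD _ t1'.
  by split; [have [] := is_derive_reflect dphi | exact: Dphi].
- by rewrite oppr0.
- have r01 : (`|- 0 : R[i]| < 1)%R by rewrite oppr0 normr0 ltr01.
  have [dphi _] := phiD _ r01.
  rewrite derive1E; have [_ ->] := is_derive_reflect dphi.
  by rewrite oppr0 -derive1E phi1 scalerN.
Qed.

Lemma kobayashi_metricN D z v :
  kobayashi_metric D z (- v) = kobayashi_metric D z v.
Proof.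
apply/eqP; rewrite eq_le kobayashi_metricN_le /=.
by rewrite -[v in X in X <= _]opprK kobayashi_metricN_le.
Qed.

Let segment x y (t : R) := (x + t%:C *: (y - x))%R.

Lemma C1_affine (a b : R) (f : R -> R) : f =1 (fun t => a + t * b)%R ->
  C1_fun f /\ derive1 f = cst b.
Proof.
move=> /funext ->.
have df (t : R) : is_derive t (1%R : R) (fun t => a + t * b)%R b.
  by apply: is_derive_eq; rewrite /GRing.scale /=; ring.
have E : derive1 (fun t => a + t * b)%R = cst b.
  by apply/funext => t; rewrite derive1E; have [_] := df t.
split=> //; split=> [t|]; first by have [] := df t.
by rewrite E; exact: cst_continuous.
Qed.

Lemma re_segment x y j t : re_coord (segment x y) j t =
  (complex.Re (x ord0 j) + t * complex.Re ((y - x) ord0 j))%R.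
Proof.
rewrite /re_coord /segment !mxE; case: (x ord0 j) (y ord0 j) => [a b] [a' b'] /=.
ring.
Qed.

Lemma im_segment x y j t : im_coord (segment x y) j t =
  (complex.Im (x ord0 j) + t * complex.Im ((y - x) ord0 j))%R.
Proof.
rewrite /im_coord /segment !mxE; case: (x ord0 j) (y ord0 j) => [a b] [a' b'] /=.
ring.
Qed.

Lemma kobayashi_dist_segment D x y (M : R) :
  (forall t : R, (0 <= t <= 1)%R -> D (segment x y t)) ->
  (forall t : R, (0 <= t <= 1)%R ->
     kobayashi_metric D (segment x y t) (y - x) <= M%:E) ->
  kobayashi_dist D x y <= M%:E.
Proof.
move=> sD sM.
have seg_curve : curve D x y [:: segment x y].
  split; last by rewrite /= /segment scale1r addrC subrK.
    split => // j.
      by have [] := C1_affine (re_segment x y j).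
    by have [] := C1_affine (im_segment x y j).
  by rewrite /segment scale0r addr0.
have veloc t : velocity (segment x y) t = (y - x)%R.
  apply/rowP => j; rewrite mxE.
  have [_ ->] := C1_affine (re_segment x y j).
  have [_ ->] := C1_affine (im_segment x y j).
  by rewrite /=; case: ((y - x)%R ord0 j).
apply: (@le_trans _ _ (kobayashi_length D [:: segment x y])).
  by apply: ereal_inf_lbound; exists [:: segment x y].
rewrite /kobayashi_length big_seq1.
have -> : M%:E = \int[@lebesgue_measure R]_(t in `[0%R, 1%R]) M%:E.
  by rewrite integral_cst //= lebesgue_measure_itv /= lte_fin ltr01 sube0 mule1.
have M0 : 0 <= M%:E.
  by apply: le_trans (sM 0%R _); rewrite ?kobayashi_metric_ge0 // lexx ler01.
apply: le_lower_integral => t; first by move=> _; exact: M0.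
rewrite /= in_itv /= => t01.
by rewrite veloc; exact: sM.
Qed.

End KobayashiDistance.

(** * The Kobayashi distance *)

Section DistanceLaws.
Context {R : realType} {N : nat}.
Implicit Types (D : set 'rV[R[i]]_N) (x y z v : 'rV[R[i]]_N).
Implicit Types (g : R -> 'rV[R[i]]_N) (s : seq (R -> 'rV[R[i]]_N)).

Lemma convex_segment D x y (t : R) : is_convex D -> D x -> D y ->
  0 <= t <= 1 -> D (x + t%:C *: (y - x)).
Proof.
move=> Dconv Dx Dy /andP[t0 t1].
have t0' : 0 <= t%:C :> R[i] by rewrite ler0c.
have t1' : t%:C <= 1 :> R[i] by rewrite -(rmorph1 (real_complex R)) lecR.
have := Dconv y x (Itv01 t0' t1') (mem_set Dy) (mem_set Dx).
rewrite inE; congr D.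
rewrite /conv /= /unstable.onem scalerBl scale1r scalerBr.
by rewrite addrCA.
Qed.

Local Open Scope ereal_scope.

(** By convexity the ball of radius [r] about any point of the segment lies in [D], its points being
    combinations of points of the two end balls. *)
Lemma kobayashi_dist_ball D x y (r : R) : is_convex D -> (0 < r)%R ->
  (forall z, (rnorm (z - x) < r)%R -> D z) ->
  (forall z, (rnorm (z - y) < r)%R -> D z) ->
  kobayashi_dist D x y <= (rnorm (y - x) / r)%:E.
Proof.
move=> Dconv r0 xD yD.
have ball_D (t : R) : (0 <= t <= 1)%R ->
    forall z, (rnorm (z - (x + t%:C *: (y - x))) < r)%R -> D z.
  move=> t01 z zr; pose w := (z - (x + t%:C *: (y - x)))%R.
  have -> : z = ((x + w) + t%:C *: ((y + w) - (x + w)))%R.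
    have -> : (y + w - (x + w) = y - x)%R by rewrite opprD addrACA subrr addr0.
    by rewrite addrAC /w addrC subrK.
  apply: convex_segment => //.
    by apply: xD; rewrite addrAC subrr add0r.
  by apply: yD; rewrite addrAC subrr add0r.
apply: kobayashi_dist_segment => t t01.
  by apply: (ball_D t t01); rewrite subrr rnorm0.
exact: kobayashi_metric_ball (ball_D t t01).
Qed.

Lemma kobayashi_dist_line D x v :
  (forall t : R[i], D (x + t *: v)%R) -> kobayashi_dist D x (x + v) = 0.
Proof.
move=> xD; apply/eqP; rewrite eq_le kobayashi_dist_ge0 andbT.
apply: kobayashi_dist_segment => t _; rewrite [(x + v)%R]addrC addrK.
  exact: xD.
by rewrite kobayashi_metric_line // => s; rewrite -addrA -scalerDl.
Qed.

Lemma kobayashi_dist_xx D x : kobayashi_dist D x x = 0.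
Proof.
apply/eqP; rewrite eq_le kobayashi_dist_ge0 andbT.
by apply: ereal_inf_lbound; exists [::] => //; rewrite /kobayashi_length big_nil.
Qed.

Lemma curve_cat D x y z s s' :
  curve D x y s -> curve D y z s' -> curve D x z (s ++ s').
Proof.
elim: s x => [x /= ->//|g s IH x [gD gx sy] s'z]; split => //.
exact: IH.
Qed.

Lemma kobayashi_length_cat D s s' :
  kobayashi_length D (s ++ s') = kobayashi_length D s + kobayashi_length D s'.
Proof. exact: big_cat. Qed.

Lemma kobayashi_dist_triangle D x y z : kobayashi_dist D x y < +oo ->
  kobayashi_dist D y z < +oo ->
  kobayashi_dist D x z <= kobayashi_dist D x y + kobayashi_dist D y z.
Proof.
move=> xy yz; apply/lee_addgt0Pr => e e0.
have e2 : (0 < e / 2)%R by rewrite divr_gt0.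
have [|_ [s xys <-] ls] := lb_ereal_inf_adherent e2
  (S := [set kobayashi_length D s | s in [set s | curve D x y s]]).
  by rewrite ge0_fin_numE ?kobayashi_dist_ge0.
have [|_ [s' yzs <-] ls'] := lb_ereal_inf_adherent e2
  (S := [set kobayashi_length D s | s in [set s | curve D y z s]]).
  by rewrite ge0_fin_numE ?kobayashi_dist_ge0.
apply: (@le_trans _ _ (kobayashi_length D (s ++ s'))).
  by apply: ereal_inf_lbound; exists (s ++ s') => //; exact: curve_cat xys yzs.
rewrite kobayashi_length_cat; apply: le_trans (leeD (ltW ls) (ltW ls')) _.
by rewrite addeACA -EFinD -splitr.
Qed.

Let onem_curve g (t : R) := g (1 - t)%R.

Lemma C1_fun_onem (f : R -> R) : C1_fun f ->
  C1_fun (fun t => f (1 - t)%R) /\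
  forall t, derive1 (fun t => f (1 - t)%R) t = (- derive1 f (1 - t))%R.
Proof.
move=> [df cf].
have d1 (t : R) : is_derive t (1%R : R) (fun t => f (1 - t))%R
    (- derive1 f (1 - t))%R.
  have dft : is_derive (1 - t)%R (1%R : R) f (derive1 f (1 - t)%R).
    by split; [exact: df | rewrite derive1E].
  have dg : is_derive t (1%R : R) (fun t : R => 1 - t)%R (-1)%R.
    by apply: is_derive_eq; rewrite /GRing.scale /=; ring.
  have := @is_derive1_comp R f (fun t => 1 - t)%R t _ _ dft dg.
  by rewrite mulrN1.
have E t : derive1 (fun t => f (1 - t)%R) t = (- derive1 f (1 - t))%R.
  by rewrite derive1E; have [_] := d1 t.
split; last exact: E.
split=> [t|]; first by have [] := d1 t.
rewrite (funext E) => t; apply: cvgN.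
apply: (@continuous_comp _ _ _ (fun t : R => 1 - t)%R (derive1 f)).
  by apply: cvgB; [exact: cvg_cst | exact: cvg_id].
exact: cf.
Qed.

Lemma velocity_onem g t : (forall j, C1_fun (re_coord g j)) ->
  (forall j, C1_fun (im_coord g j)) ->
  velocity (onem_curve g) t = (- velocity g (1 - t))%R.
Proof.
move=> re_g im_g; apply/rowP => j; rewrite !mxE.
have [_ rej] := C1_fun_onem (re_g j); have [_ imj] := C1_fun_onem (im_g j).
by rewrite -[RHS]/(_ +i* _) -(rej t) -(imj t).
Qed.

Lemma C1_arc_onem D g : C1_arc D g -> C1_arc D (onem_curve g).
Proof.
move=> [re_g im_g gD]; split => [j|j|t /andP[t0 t1]].
- by have [] := C1_fun_onem (re_g j).
- by have [] := C1_fun_onem (im_g j).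
- by apply: gD; rewrite subr_ge0 t1 gerBl.
Qed.

Lemma curve_rev D x y s :
  curve D x y s -> curve D y x (rev (map onem_curve s)).
Proof.
elim: s x => [x /= ->//|g s IH x [gD gx sy]].
rewrite /= rev_cons -cats1; apply: curve_cat (IH _ sy) _.
split; first exact: C1_arc_onem.
  by rewrite /onem_curve subr0.
by rewrite /= /onem_curve subrr.
Qed.

Lemma kobayashi_length_rev D x y s : curve D x y s ->
  kobayashi_length D (rev (map onem_curve s)) <= kobayashi_length D s.
Proof.
elim: s x => [x _|g s IH x [gD gx sy]].
  by rewrite /kobayashi_length big_nil.
rewrite /= rev_cons -cats1 kobayashi_length_cat addeC.
rewrite [X in _ <= X]/kobayashi_length big_cons; apply: leeD; last exact: IH sy.
rewrite /kobayashi_length big_seq1.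
pose h t := kobayashi_metric D (g t) (velocity g t).
apply: le_trans (lower_integral_onem (h := h) _); last first.
  by move=> t; exact: kobayashi_metric_ge0.
apply: le_lower_integral => t _; first exact: kobayashi_metric_ge0.
by have [re_g im_g _] := gD; rewrite velocity_onem // kobayashi_metricN.
Qed.

Lemma kobayashi_dist_sym D x y : kobayashi_dist D x y = kobayashi_dist D y x.
Proof.
suff le_sym a b : kobayashi_dist D a b <= kobayashi_dist D b a.
  by apply/eqP; rewrite eq_le !le_sym.
apply: le_ereal_inf_tmp => _ [s bas <-].
apply: le_trans (kobayashi_length_rev bas).
by apply: ereal_inf_lbound; exists (rev (map onem_curve s)) => //; exact: curve_rev.
Qed.

End DistanceLaws.

(** * Convex geometry *)

Section Convergence.
Context {R : realType} {N : nat}.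
Implicit Types (v x y z : 'rV[R[i]]_N) (D : set 'rV[R[i]]_N).

Lemma open_rnorm D x : open D -> D x ->
  exists2 r : R, 0 < r & forall y, rnorm (y - x) < r -> D y.
Proof. by move=> Do Dx; apply/nbhs_rnormP; exact: open_nbhs_nbhs. Qed.

Lemma closure_rnormP D z :
  closure D z <-> forall r : R, 0 < r -> exists2 y, D y & rnorm (y - z) < r.
Proof.
split=> [Dz r r0|Dz A].
  have [y [Dy yz]] : D `&` [set y | rnorm (y - z) < r] !=set0.
    by apply: Dz; apply/nbhs_rnormP; exists r.
  by exists y.
by move/nbhs_rnormP => [r /Dz[y Dy yz] rA]; exists y; split => //; exact: rA.
Qed.

Lemma boundary_open D z : open D -> boundary D z <-> closure D z /\ ~ D z.
Proof. by move=> /interior_id Do; rewrite /boundary Do. Qed.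

Lemma rnorm_le_coord v (d : R) : 0 <= d ->
  (forall j, rnorm (v ord0 j) <= d) -> rnorm v <= d.
Proof.
move=> d0 vd; apply/ler_addgt0Pr => e e0; apply: ltW; apply/rnorm_lt_coordP.
split=> [|j]; first by rewrite ltr_wpDl.
by apply: le_lt_trans (vd j) _; rewrite ltrDl.
Qed.

Definition cauchy_rnorm (u : nat -> 'rV[R[i]]_N) := forall e : R, 0 < e ->
  exists n0, forall m n, (n0 <= m)%N -> (n0 <= n)%N -> rnorm (u m - u n) < e.

Definition cvg_rnorm (u : nat -> 'rV[R[i]]_N) z := forall e : R, 0 < e ->
  exists n0, forall n, (n0 <= n)%N -> rnorm (u n - z) < e.

Lemma real_cauchy (a : nat -> R) :
  (forall e : R, 0 < e -> exists n0, forall m n, (n0 <= m)%N -> (n0 <= n)%N ->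
     `|a m - a n| < e) ->
  exists l : R, forall e : R, 0 < e -> exists n0, forall n, (n0 <= n)%N ->
     `|a n - l| < e.
Proof.
move=> ac; have : cvg (a @ \oo).
  apply/cauchy_cvgP/cauchy_exP => e /= e0; have [n0 an0] := ac e e0.
  by exists (a n0), n0 => // n /= n0n; rewrite -ball_normE /=; exact: an0.
move=> /cvg_ex[l al]; exists l => e e0.
move/cvgrPdist_lt : al => /(_ e e0)[n0 _ n0P].
by exists n0 => n /n0P; rewrite distrC.
Qed.

Lemma cauchy_cvg_rnorm (u : nat -> 'rV[R[i]]_N) : cauchy_rnorm u ->
  exists z, cvg_rnorm u z.
Proof.
move=> uc.
have coord (f : R[i] -> R) (j : 'I_N) : (forall a b, f (a - b) = f a - f b) ->
    (forall a, `|f a| <= rnorm a) ->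
    exists l : R, forall e : R, 0 < e -> exists n0, forall n, (n0 <= n)%N ->
     `|f (u n ord0 j) - l| < e.
  move=> fB f1; apply: real_cauchy => e /uc[n0 n0P]; exists n0 => m n n0m n0n.
  rewrite -fB; apply: le_lt_trans (f1 _) _.
  by have := rnorm_coord (u m - u n) j; rewrite !mxE => /le_lt_trans; apply; exact: n0P.
have [a aP] : {a : 'I_N -> R & forall j, forall e : R, 0 < e -> exists n0,
    forall n, (n0 <= n)%N -> `|complex.Re (u n ord0 j) - a j| < e}.
  apply: (@choice 'I_N R (fun j l => forall e : R, 0 < e -> exists n0,
    forall n, (n0 <= n)%N -> `|complex.Re (u n ord0 j) - l| < e)) => j.
  by apply: coord => [? ?|]; [rewrite raddfB | exact: Re_le_rnorm].
have [b bP] : {b : 'I_N -> R & forall j, forall e : R, 0 < e -> exists n0,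
    forall n, (n0 <= n)%N -> `|complex.Im (u n ord0 j) - b j| < e}.
  apply: (@choice 'I_N R (fun j l => forall e : R, 0 < e -> exists n0,
    forall n, (n0 <= n)%N -> `|complex.Im (u n ord0 j) - l| < e)) => j.
  by apply: coord => [? ?|]; [rewrite raddfB | exact: Im_le_rnorm].
exists (\row_j (a j +i* b j)) => e e0.
have e2 : 0 < e / 2 by rewrite divr_gt0.
have [na naP] : {na : 'I_N -> nat & forall j n, (na j <= n)%N ->
    `|complex.Re (u n ord0 j) - a j| < e / 2}.
  apply: (@choice 'I_N nat (fun j n0 => forall n, (n0 <= n)%N ->
    `|complex.Re (u n ord0 j) - a j| < e / 2)) => j; exact: aP.
have [nb nbP] : {nb : 'I_N -> nat & forall j n, (nb j <= n)%N ->
    `|complex.Im (u n ord0 j) - b j| < e / 2}.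
  apply: (@choice 'I_N nat (fun j n0 => forall n, (n0 <= n)%N ->
    `|complex.Im (u n ord0 j) - b j| < e / 2)) => j; exact: bP.
exists (\max_j (maxn (na j) (nb j)))%N => n /bigmax_leqP n0P.
apply/rnorm_lt_coordP; split => // j.
have := n0P j isT; rewrite geq_max => /andP[/naP uan /nbP ubn].
apply: le_lt_trans (rnorm_le_ReIm _) _; rewrite !mxE.
move: uan ubn; case: (u n ord0 j) => p q /= uan ubn; lra.
Qed.

End Convergence.

(** * Closure points and lines of open convex sets *)

Section ConvexGeometry.
Context {R : realType} {N : nat}.
Implicit Types (v x y z q : 'rV[R[i]]_N) (D : set 'rV[R[i]]_N).

Lemma convex_interior_segment D x z (t : R) : open D -> is_convex D ->
  D x -> closure D z -> 0 <= t < 1 -> D (x + t%:C *: (z - x)).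
Proof.
move=> Do Dconv Dx Dz /andP[t0 t1].
have [r r0 rD] := open_rnorm Do Dx.
have t1' : 0 < 1 - t by rewrite subr_gt0.
have tc : (1 - t)%:C != 0 :> R[i].
  by rewrite (fmorph_eq0 (real_complex R)) gt_eqF.
have /closure_rnormP/(_ _ (mulr_gt0 r0 t1')) [y Dy yz] := Dz.
(* [x'] absorbs the error of replacing [z] by [y], and stays in the ball about [x]. *)
pose x' := x + (t / (1 - t))%:C *: (z - y).
have Dx' : D x'.
  apply: rD; rewrite addrAC subrr add0r rnormZ rnorm_real.
  rewrite ger0_norm ?divr_ge0 ?(ltW t1') // rnormB.
  rewrite mulrAC ltr_pdivrMr //; apply: le_lt_trans yz.
  by rewrite ler_piMl ?rnorm_ge0 // ltW.
have -> : x + t%:C *: (z - x) = x' + t%:C *: (y - x').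
  have E : (t / (1 - t))%:C = t%:C / (1 - t)%:C :> R[i].
    by rewrite rmorphM fmorphV.
  have tE : t%:C = 1 - (1 - t)%:C :> R[i] by rewrite rmorphB /= opprB addrC subrK.
  apply/rowP => j; rewrite !mxE E; move: tc; rewrite tE.
  by move: ((1 - t)%:C) => s s0; field.
by apply: convex_segment => //; rewrite t0 ltW.
Qed.

(** For small [t], [x + zeta *: v] is close to the combination with weights [1 - t] and [t] of [x]
    and the far point [q + (zeta / t) *: v]. The error is moved into [x], which is interior. *)
Lemma convex_line_direction D q v : open D -> is_convex D ->
  (forall zeta : R[i], closure D (q + zeta *: v)) ->
  forall x (zeta : R[i]), D x -> D (x + zeta *: v).
Proof.
move=> Do Dconv qD x zeta Dx.
have [r r0 rD] := open_rnorm Do Dx.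
pose s := rnorm (x - q) + 1.
have s0 : 0 < s by rewrite ltr_wpDl ?rnorm_ge0.
(* [t <= 1 / 2] bounds [1 / (1 - t)] by 2, so that [x'] below is within [2 * t * s <= r / 2] of
   [x]. *)
pose t := Num.min (1 / 2) (r / (4 * s)).
have t0 : 0 < t by rewrite lt_min divr_gt0 //= divr_gt0 // mulr_gt0.
have t1 : t <= 1 / 2 by rewrite ge_min lexx.
have ts : t * (4 * s) <= r.
  by rewrite -ler_pdivlMr ?mulr_gt0 // ge_min lexx orbT.
have tc : t%:C != 0 :> R[i] by rewrite (fmorph_eq0 (real_complex R)) gt_eqF.
have t1c : 1 - t%:C != 0 :> R[i].
  rewrite -(rmorph1 (real_complex R)) -rmorphB (fmorph_eq0 (real_complex R)).
  by rewrite gt_eqF //= subr_gt0; lra.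
have /closure_rnormP/(_ _ ltr01) [y Dy yq] := qD (zeta / t%:C).
pose x' := x + (t / (1 - t))%:C *: (x - q + (q + (zeta / t%:C) *: v - y)).
have E : (t / (1 - t))%:C = t%:C / (1 - t%:C) :> R[i].
  by rewrite rmorphM fmorphV rmorphB.
have Dx' : D x'.
  apply: rD; rewrite addrAC subrr add0r rnormZ rnorm_real.
  rewrite ger0_norm ?divr_ge0 ?(ltW t0) ?subr_ge0 //; last by lra.
  have le2 : t / (1 - t) <= t * 2.
    by rewrite ler_wpM2l ?(ltW t0) // invf_ple ?posrE; lra.
  have ns : rnorm (x - q + (q + (zeta / t%:C) *: v - y)) <= s.
    by apply: le_trans (rnormD _ _) _; rewrite lerD2l rnormB ltW.
  have ge0 : 0 <= t / (1 - t) by rewrite divr_ge0 ?(ltW t0) // subr_ge0; lra.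
  apply: le_lt_trans (ler_pM ge0 (rnorm_ge0 _) le2 ns) _.
  have : 0 < t * s by rewrite mulr_gt0.
  lra.
have -> : x + zeta *: v = x' + t%:C *: (y - x').
  apply/rowP => j; rewrite !mxE E; move: tc t1c.
  by move: (t%:C) => s' s0' s1'; field; rewrite s0' s1'.
apply: convex_segment => //; apply/andP; split; lra.
Qed.

End ConvexGeometry.

(** * Strict separation by a nearest point *)

Section Separation.
Context {R : realType} {N : nat}.
Implicit Types (v w x y z : 'rV[R[i]]_N) (D : set 'rV[R[i]]_N).

(** The max norm of ['rV] has no parallelogram law; nearest points are taken for the Euclidean
    norm. *)
Definition sqnorm v : R := \sum_j rnorm (v ord0 j) ^+ 2.

Definition conj_col w : 'cV[R[i]]_N := \col_j (w ord0 j)^*.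

Definition inner v w : R := complex.Re (linform (conj_col w) v).

Lemma sqnorm_ge0 v : 0 <= sqnorm v.
Proof. by apply: sumr_ge0 => j _; exact: sqr_ge0. Qed.

Lemma innerE v w : inner v w = \sum_j
  (complex.Re (v ord0 j) * complex.Re (w ord0 j)
   + complex.Im (v ord0 j) * complex.Im (w ord0 j)).
Proof.
rewrite /inner /linform raddf_sum; apply: eq_bigr => j _; rewrite mxE.
by case: (v ord0 j) (w ord0 j) => [a b] [a' b'] /=; ring.
Qed.

Lemma sqnormE v : sqnorm v = inner v v.
Proof.
by rewrite innerE; apply: eq_bigr => j _; rewrite rnorm_sqr !expr2.
Qed.

Lemma innerC v w : inner v w = inner w v.
Proof. by rewrite !innerE; apply: eq_bigr => j _; ring. Qed.

Lemma innerDl v w x : inner (v + w) x = inner v x + inner w x.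
Proof. by rewrite /inner linformD raddfD. Qed.

Lemma innerZl (t : R) v w : inner (t%:C *: v) w = t * inner v w.
Proof.
by rewrite /inner linformZ; case: (linform _ v) => a b /=; rewrite mul0r subr0.
Qed.

Lemma sqnorm_lin v w (t : R) :
  sqnorm (v + t%:C *: w) = sqnorm v + 2 * t * inner w v + t ^+ 2 * sqnorm w.
Proof.
rewrite !sqnormE innerDl innerZl [inner v (v + _)]innerC [inner w (v + _)]innerC.
rewrite !innerDl !innerZl [inner v w]innerC; ring.
Qed.

Lemma sqnormZ (t : R) v : sqnorm (t%:C *: v) = t ^+ 2 * sqnorm v.
Proof. by rewrite !sqnormE innerZl innerC innerZl mulrA expr2. Qed.

Lemma sqnorm_le v : sqnorm v <= N%:R * rnorm v ^+ 2.
Proof.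
have -> : N%:R * rnorm v ^+ 2 = \sum_(j < N) rnorm v ^+ 2.
  by rewrite sumr_const card_ord mulr_natl.
by apply: ler_sum => j _; rewrite ler_sqr ?nnegrE ?rnorm_ge0 // rnorm_coord.
Qed.

Lemma rnorm_lt_sqnorm v (e : R) : 0 < e -> sqnorm v < e ^+ 2 -> rnorm v < e.
Proof.
move=> e0 ve; apply/rnorm_lt_coordP; split => // j.
rewrite -ltr_sqr ?nnegrE ?rnorm_ge0 ?(ltW e0) //; apply: le_lt_trans ve.
by rewrite /sqnorm (bigD1 j) //= lerDl sumr_ge0 // => k _; exact: sqr_ge0.
Qed.

Lemma sqnorm_gt0 v : v != 0 -> 0 < sqnorm v.
Proof.
move=> v0; rewrite lt_neqAle sqnorm_ge0 andbT eq_sym; apply: contra_neq v0 => v0.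
apply: rnorm0_eq0; apply/eqP; rewrite eq_le rnorm_ge0 andbT.
apply/ler_addgt0Pr => e e0; rewrite add0r; apply/ltW/rnorm_lt_sqnorm => //.
by rewrite v0 exprn_gt0.
Qed.

(** Passes an inequality between squared norms to a limit without square roots: the cross term is
    absorbed by a small multiple of [sqnorm w]. *)
Lemma sqnorm_limit (A B : R) : 0 <= B ->
  (forall e : R, 0 < e -> exists v w,
     [/\ A <= sqnorm v, sqnorm w <= B + e & sqnorm (v - w) <= e]) ->
  A <= B.
Proof.
move=> B0 AB; apply/ler_addgt0Pr => d d0.
pose s := Num.min 1 (d / (2 * (B + 1))).
have B1 : 0 < 2 * (B + 1) by rewrite mulr_gt0 // ltr_wpDl.
have s0 : 0 < s by rewrite lt_min ltr01 divr_gt0.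
have s1 : s <= 1 by rewrite ge_min lexx.
have sB : s * (2 * (B + 1)) <= d by rewrite -ler_pdivlMr // ge_min lexx orbT.
(* The errors [e], [s * W], [s^-1 * V] and [V] below are then at most [d / 8], [5 * d / 8], [d / 8]
   and [d / 8]. *)
pose e := s * d / 8.
have e0 : 0 < e by rewrite divr_gt0 // mulr_gt0.
have [v [w [Av wB vw]]] := AB e e0.
apply: le_trans Av _.
have -> : v = w + 1%:C *: (v - w) by rewrite scale1r addrC subrK.
rewrite sqnorm_lin.
(* [0 <= |(v - w) / s - w|^2] bounds the cross term *)
have := sqnorm_ge0 (w + (- s^-1)%:C *: (v - w)); rewrite sqnorm_lin.
move: (inner _ _) (sqnorm w) (sqnorm_ge0 w) wB (sqnorm (v - w)) vw => I W W0 wB V vw.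
have -> : W + 2 * - s^-1 * I + (- s^-1) ^+ 2 * V = (s * W - 2 * I + s^-1 * V) / s.
  by field; exact: lt0r_neq0.
rewrite pmulr_lge0 ?invr_gt0 // => H.
have sV : s^-1 * V <= d / 8.
  rewrite ler_pdivrMl // [X in _ <= X](_ : _ = e) // /e; ring.
have sW : s * W <= s * (B + e) by rewrite ler_pM2l.
have ed : e <= d / 8 by rewrite /e ler_pM2r // ler_piMl // ltW.
have se : s * e <= e by rewrite ler_piMl // ltW.
lra.
Qed.

(** The first-order condition at a minimum, with an explicit [t] in place of a limit. *)
Lemma linear_part_ge0 (a b : R) : 0 <= b ->
  (forall t, 0 < t -> t <= 1 -> 0 <= 2 * t * a + t ^+ 2 * b) -> 0 <= a.
Proof.
move=> b0 ab; rewrite leNgt; apply/negP => a0.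
pose t := Num.min 1 (- a / (b + 1)).
have b1 : 0 < b + 1 by rewrite ltr_wpDl.
have t0 : 0 < t by rewrite lt_min ltr01 divr_gt0 // oppr_gt0.
have t1 : t <= 1 by rewrite ge_min lexx.
have tb : t * (b + 1) <= - a by rewrite -ler_pdivlMr // ge_min lexx orbT.
have := ab t t0 t1.
have -> : 2 * t * a + t ^+ 2 * b = t * (2 * a + t * b) by ring.
rewrite pmulr_rge0 //; lra.
Qed.

(** With [q] the point of the closure nearest to [z], the functional is the Hermitian product with
    [q - z]. Minimality along segments from [q] gives a real part of at least [sqnorm (q - z)] on
    [D]; [b] makes the complex value at [z] vanish, not only its real part. *)
Theorem strict_separation D z : is_convex D -> D !=set0 -> ~ closure D z ->
  exists c : 'cV[R[i]]_N, exists b : R[i],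
    (forall y, D y -> 0 < complex.Re (linform c y + b)) /\ linform c z + b = 0.
Proof.
move=> Dconv [y0 Dy0] Dz.
pose E := [set sqnorm (y - z) | y in D].
have E_inf : has_inf E.
  split; first by exists (sqnorm (y0 - z)), y0.
  by exists 0 => _ [y _ <-]; exact: sqnorm_ge0.
pose d := inf E.
have d_le y : D y -> d <= sqnorm (y - z).
  by move=> Dy; apply: ge_inf; [case: E_inf | exists y].
have d0 : 0 <= d.
  by apply: lb_le_inf; [case: E_inf | move=> _ [y _ <-]; exact: sqnorm_ge0].
have [p pP] : {p : nat -> 'rV[R[i]]_N & forall n,
    D (p n) /\ sqnorm (p n - z) < d + n.+1%:R^-1}.
  apply: (@choice nat _ (fun n q => D q /\ sqnorm (q - z) < d + n.+1%:R^-1)) => n.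
  have n0 : 0 < n.+1%:R^-1 :> R by rewrite invr_gt0.
  by have [_ [q Dq <-] qd] := inf_adherent n0 E_inf; exists q.
have p_cauchy : cauchy_rnorm p.
  move=> e e0; pose n0 := Num.truncn (4 / e ^+ 2).
  have n0e n : (n0 <= n)%N -> 4 * n.+1%:R^-1 < e ^+ 2.
    move=> n0n; rewrite ltr_pdivrMr // mulrC -ltr_pdivrMr ?exprn_gt0 //.
    apply: lt_le_trans (truncnS_gt _) _.
    by rewrite ler_nat.
  exists n0 => m n /n0e n0m /n0e n0n; apply: rnorm_lt_sqnorm => //.
  have [Dm pm] := pP m; have [Dn pn] := pP n.
  (* By the parallelogram law at the midpoint, [sqnorm (p m - p n)] is at most twice the sum of the
     excesses [m.+1%:R^-1] and [n.+1%:R^-1], each below [e ^+ 2 / 4]. *)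
  have /d_le : D (p n + (1 / 2)%:C *: (p m - p n)).
    by apply: convex_segment => //; lra.
  have -> : p n + (1 / 2)%:C *: (p m - p n) - z =
    (p n - z) + (1 / 2)%:C *: (p m - p n) by rewrite addrAC.
  rewrite sqnorm_lin => dmn.
  have pmE : p m - z = (p n - z) + 1%:C *: (p m - p n).
    by rewrite scale1r [RHS]addrC addrA subrK.
  move: pm n0m n0n pn; rewrite pmE sqnorm_lin.
  by move: (m.+1%:R^-1) (n.+1%:R^-1) => mi ni; lra.
have [q pq] := cauchy_cvg_rnorm p_cauchy.
have p_near (e : R) : 0 < e -> exists n, sqnorm (p n - q) <= e /\ n.+1%:R^-1 <= e.
  move=> e0; have N0 : 0 < N.+1%:R :> R by [].
  pose e1 := Num.min 1 (e / N.+1%:R).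
  have e10 : 0 < e1 by rewrite lt_min ltr01 divr_gt0.
  have [n0 n0P] := pq e1 e10.
  pose n1 := Num.truncn (1 / e).
  exists (maxn n0 n1); split.
    apply: le_trans (sqnorm_le _) _.
    have := n0P _ (leq_maxl n0 n1); move: (p _ - q) => v ve.
    have e11 : e1 <= 1 by rewrite ge_min lexx.
    have e1e : e1 * N.+1%:R <= e by rewrite -ler_pdivlMr // ge_min lexx orbT.
    have v2 : rnorm v ^+ 2 <= e1.
      have := rnorm_ge0 v; rewrite expr2; nra.
    apply: le_trans e1e; rewrite mulrC; apply: ler_pM => //.
    - exact: sqr_ge0.
    - by rewrite ler_nat.
  rewrite -[X in _ <= X]invrK lef_pV2 ?posrE ?invr_gt0 //.
  rewrite -[e^-1]mul1r; apply: le_trans (ltW (truncnS_gt _)) _.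
  by rewrite ler_nat ltnS leq_maxr.
have closure_q : closure D q.
  apply/closure_rnormP => r r0; have [n0 n0P] := pq r r0.
  by exists (p n0); [have [] := pP n0 | exact: n0P].
have q_le : sqnorm (q - z) <= d.
  apply: (sqnorm_limit d0) => e e0; have [n [pnq ne]] := p_near e e0.
  exists (q - z), (p n - z); split; first exact: lexx.
    by have [_ /ltW] := pP n; move/le_trans; apply; rewrite lerD2l.
  rewrite opprB addrA subrK -[_ - _]opprB -scaleN1r.
  by rewrite -(rmorph1 (real_complex R)) -rmorphN sqnormZ sqrrN expr1n mul1r.
(* [q] is only known to lie in the closure; minimality is passed to it from the segments issuing
   from [p n]. *)
have q_ge y (t : R) : D y -> 0 <= t <= 1 -> d <= sqnorm (q - z + t%:C *: (y - q)).
  move=> Dy /andP[t0 t1]; apply: (sqnorm_limit (sqnorm_ge0 _)) => e e0.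
  have [n [pnq ne]] := p_near e e0; have [Dpn _] := pP n.
  exists (p n + t%:C *: (y - p n) - z), (q - z + t%:C *: (y - q)); split.
  - by apply: d_le; apply: (convex_segment Dconv Dpn Dy); rewrite t0.
  - by rewrite lerDl ltW.
  have -> : p n + t%:C *: (y - p n) - z - (q - z + t%:C *: (y - q)) =
      (1 - t)%:C *: (p n - q).
    rewrite rmorphB rmorph1; apply/rowP => j; rewrite !mxE; ring.
  rewrite sqnormZ; move: pnq (sqnorm_ge0 (p n - q)).
  move: (sqnorm _) => S S1 S0.
  have : 0 <= t * (2 - t) * S.
    apply: mulr_ge0 S0; apply: mulr_ge0; first exact: t0.
    by rewrite subr_ge0; apply: le_trans t1 _; rewrite ler1n.
  have -> : (1 - t) ^+ 2 * S = S - t * (2 - t) * S by ring.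
  by rewrite lerBlDr => tS0; apply: le_trans S1 _; rewrite lerDl.
have q_neq_z : q - z != 0.
  by rewrite subr_eq0; apply: contra_not_neq Dz => <-.
have q0 := sqnorm_gt0 q_neq_z.
exists (conj_col (q - z)), (- linform (conj_col (q - z)) z); split => [y Dy|].
  rewrite -linformB -/(inner (y - z) (q - z)).
  have -> : y - z = (y - q) + (q - z) by rewrite addrA subrK.
  rewrite innerDl -(sqnormE (q - z)); apply: ltr_wpDl q0.
  apply: (linear_part_ge0 (sqnorm_ge0 (y - q))) => t t0 t1.
  have t01 : 0 <= t <= 1 by rewrite (ltW t0) t1.
  have := le_trans q_le (q_ge y t Dy t01).
  by rewrite sqnorm_lin -[X in X <= _]addr0 -addrA lerD2l.
by rewrite subrr.
Qed.

End Separation.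

(** * Domains without complex lines *)

Section Coercivity.
Context {R : realType} {N : nat}.
Variable D : set 'rV[R[i]]_N.
Hypothesis D_domain : is_domain D.
Hypothesis D_convex : is_convex D.
Hypothesis D_no_line : ~ contains_complex_affine_line D.
Implicit Types (v x y z : 'rV[R[i]]_N).

(** [b] is left free, since the rank argument concerns the linear part. *)
Definition bounded_functional (c : 'cV[R[i]]_N) :=
  exists b : R[i], forall y, D y -> 0 < complex.Re (linform c y + b).

Lemma linform_mulmx (c : 'cV[R[i]]_N) y : linform c y = (y *m c) ord0 ord0.
Proof. by rewrite mxE. Qed.

(** If all these functionals kill [v], they are constant on the line through [x] in direction [v],
    so none of its points is strictly separated from [D]. The line then lies in the closure, hence
    in [D]. *)
Lemma bounded_functionals_separate v : v != 0 ->
  exists2 c, bounded_functional c & linform c v != 0.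
Proof.
move=> v0; have [[x Dx] Do _] := D_domain.
apply: contrapT => no_c; apply: D_no_line.
have vc c : bounded_functional c -> linform c v = 0.
  move=> bc; apply/eqP; apply: contrapT => /negP cv; apply: no_c.
  by exists c.
have xD (zeta : R[i]) : closure D (x + zeta *: v).
  apply: contrapT => zD.
  have [||c [b [cb cz]]] := strict_separation _ _ zD; [by []|by exists x|].
  have := cb x Dx; move: cz; rewrite linformD linformZ vc; last by exists b.
  by rewrite mulr0 addr0 => -> /=; rewrite ltxx.
exists [set x + zeta *: v | zeta in setT]; first by exists x, v.
move=> _ [zeta _ <-]; exact: (convex_line_direction Do D_convex xD).
Qed.

(** While the rank is below [N], some [v != 0] is killed by all rows; a functional that does not
    kill [v] is independent of them. *)
Lemma bounded_functional_family k : (k <= N)%N ->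
  exists2 A : 'M[R[i]]_(k, N), \rank A = k &
    forall j, bounded_functional (row j A)^T.
Proof.
elim: k => [_|k IH kN]; first by exists 0; [rewrite mxrank0 | case].
have [A rA AP] := IH (ltnW kN).
have /rowV0Pn[v v_ker v0] : kermx A^T != 0.
  by rewrite -mxrank_eq0 mxrank_ker mxrank_tr rA subn_eq0 -ltnNge.
have [c bc cv] := bounded_functionals_separate v0.
pose A' : 'M[R[i]]_(1 + k, N) := col_mx c^T A.
have lt_A : (A < A')%MS.
  rewrite ltmxE; apply/andP; split.
    by have := submx_refl A'; rewrite {1}/A' col_mx_sub => /andP[].
  rewrite /A' col_mx_sub submx_refl andbT; apply: contra cv => /submxP[a ca].
  have vA : v *m A^T = 0 by apply/sub_kermxP.
  by rewrite linform_mulmx -[c]trmxK ca trmx_mul mulmxA vA mul0mx mxE.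
have AP' (j : 'I_(1 + k)) : bounded_functional (row j A')^T.
  rewrite /A'; have [j' ->|j' ->] := split_ordP j.
    by rewrite rowKu row_id trmxK.
  by rewrite rowKd; exact: AP.
exists A'; last exact: AP'.
apply/eqP; rewrite eqn_leq; apply/andP; split; first exact: rank_leq_row.
by rewrite -[X in (X < _)%N]rA; exact: rank_ltmx.
Qed.


Lemma coercive_functionals : exists (c : 'I_N -> 'cV[R[i]]_N) (M : R),
  [/\ forall j, bounded_functional (c j), 0 < M &
    forall (y : 'rV[R[i]]_N) (d : R), 0 <= d ->
    (forall j, rnorm (linform (c j) y) <= d) -> rnorm y <= M * d].
Proof.
have [A rA AP] := bounded_functional_family (leqnn N).
have uA : A \in unitmx by rewrite -row_full_unit /row_full rA.
pose B := invmx A; pose M : R := 1 + \sum_i \sum_j rnorm (B i j).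
have B0 i : 0 <= \sum_j rnorm (B i j) by apply: sumr_ge0 => j _; exact: rnorm_ge0.
exists (fun j => (row j A)^T), M; split=> // [|y d d0 yd].
  by rewrite ltr_pwDl // sumr_ge0.
apply: rnorm_le_coord => [|i].
  by rewrite mulr_ge0 // addr_ge0 // sumr_ge0.
have yE : y ord0 i = \sum_j B i j * linform (row j A)^T y.
  have : y^T = B *m (A *m y^T) by rewrite mulmxA mulVmx // mul1mx.
  move=> /(congr1 (fun Y : 'cV_N => Y i ord0)); rewrite mxE => ->.
  rewrite mxE; apply: eq_bigr => j _; congr (_ * _).
  by rewrite /linform mxE; apply: eq_bigr => l _; rewrite !mxE mulrC.
rewrite yE; apply: (@le_trans _ _ (\sum_j rnorm (B i j) * d)).
  elim/big_ind2 : _ => [|a a' b b' aa' bb'|j _].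
  - by rewrite rnorm0.
  - by apply: le_trans (rnormD _ _) _; exact: lerD.
  - by rewrite rnormM ler_wpM2l ?rnorm_ge0.
rewrite -mulr_suml; apply: ler_wpM2r => //.
rewrite /M [X in _ <= 1 + X](bigD1 i) //=.
have : 0 <= \sum_(l | l != i) \sum_j rnorm (B l j) by apply: sumr_ge0.
by move: (\sum_(l | l != i) _) (\sum_j rnorm (B i j)) => s1 s2; lra.
Qed.

End Coercivity.

(** * Completeness of the Kobayashi distance *)

Section Completeness.
Context {R : realType} {N : nat}.
Variable D : set 'rV[R[i]]_N.
Hypothesis D_domain : is_domain D.
Hypothesis D_convex : is_convex D.
Hypothesis D_no_line : ~ contains_complex_affine_line D.
Implicit Types (x y z : 'rV[R[i]]_N) (u : nat -> 'rV[R[i]]_N).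

Let K : R := 4 * expR 1.

Let K0 : 0 < K.
Proof. by rewrite mulr_gt0 // expR_gt0. Qed.

Let D_open : open D.
Proof. by have [] := D_domain. Qed.

Lemma kobayashi_dist_fin x y : D x -> D y -> (kobayashi_dist D x y < +oo)%E.
Proof.
move=> Dx Dy; have [r r0 rx] := open_rnorm D_open Dx.
have [r' r'0 ry] := open_rnorm D_open Dy.
apply: le_lt_trans (ltry (rnorm (y - x) / Num.min r r')).
apply: kobayashi_dist_ball => //; first by rewrite lt_min r0.
  by move=> z; rewrite lt_min => /andP[zr _]; exact: rx.
by move=> z; rewrite lt_min => /andP[_ zr]; exact: ry.
Qed.

Lemma kobayashi_dist_eq0 x y : D x -> D y -> kobayashi_dist D x y = 0%E -> x = y.
Proof.
move=> Dx Dy xy0.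
have [c [M [cb M0 cM]]] := coercive_functionals D_domain D_convex D_no_line.
have cE j : linform (c j) (y - x) = 0.
  have [b bP] := cb j; apply: rnorm0_eq0; apply/eqP.
  rewrite eq_le rnorm_ge0 andbT; apply/ler_addgt0Pr => e e0; rewrite add0r.
  pose W z := linform (c j) z + b; pose Q := rnorm (W y + (W x)^*).
  have Q1 : 0 < K * (Q + 1) by rewrite mulr_gt0 // ltr_wpDl ?rnorm_ge0.
  have e1 : 0 < e / (K * (Q + 1)) by rewrite divr_gt0.
  have xy_lt : (kobayashi_dist D x y < (e / (K * (Q + 1)))%:E)%E.
    by rewrite xy0 lte_fin.
  have := kobayashi_dist_pseudohyperbolic bP Dx Dy xy_lt.
  have -> : W y - W x = linform (c j) (y - x).
    by rewrite linformB /W; ring.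
  rewrite -/K -/Q => /le_trans; apply.
  rewrite [X in _ <= X](_ : e = K * (e / (K * (Q + 1))) * (Q + 1)); last first.
    by field; rewrite !gt_eqF //=; move: Q1; rewrite pmulr_rgt0.
  apply: ler_wpM2l; last by rewrite lerDl.
  by rewrite mulr_ge0 // ltW.
apply/esym/subr0_eq/rnorm0_eq0/eqP; rewrite eq_le rnorm_ge0 andbT.
rewrite -(mulr0 M); apply: cM => // j.
by rewrite cE rnorm0.
Qed.

Lemma cauchy_functional (c : 'cV[R[i]]_N) (b : R[i]) u :
  (forall y, D y -> 0 < complex.Re (linform c y + b)) ->
  (forall n, D (u n)) -> cauchy_seq_for (kobayashi_dist D) u ->
  forall e : R, 0 < e -> exists n0, forall m n, (n0 <= m)%N -> (n0 <= n)%N ->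
    rnorm (linform c (u m - u n)) <= e.
Proof.
move=> bP uD uc; pose W y : R[i] := linform c y + b.
have WB y z : linform c (y - z) = W y - W z by rewrite linformB /W; ring.
(* This radius makes the pseudo-hyperbolic distance to [W (u n0)] at most 1/2, whence
   [rnorm (W (u n)) <= 3 * A]. *)
have [n0 n0P] := uc (1 / (2 * K)) (divr_gt0 ltr01 (mulr_gt0 (ltr0Sn _ 1) K0)).
pose A := rnorm (W (u n0)).
have WA n : (n0 <= n)%N -> rnorm (W (u n)) <= 3 * A.
  move=> n0n; have := n0P n0 n (leqnn _) n0n.
  move=> /(kobayashi_dist_pseudohyperbolic bP (uD _) (uD _)).
  rewrite -/(W (u n)) -/(W (u n0)) -/K.
  have -> : K * (1 / (2 * K)) = 1 / 2 by field; rewrite gt_eqF.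
  have := rnormD (W (u n)) (W (u n0))^*.
  have -> : rnorm (W (u n0))^* = A by rewrite /rnorm normcJ.
  have := rnormD (W (u n) - W (u n0)) (W (u n0)); rewrite subrK -/A; lra.
have A0 : 0 <= A := rnorm_ge0 _.
move=> e e0; have A1 : 0 < 6 * K * (A + 1) by rewrite !mulr_gt0 // ltr_wpDl.
have [n1 n1P] := uc (e / (6 * K * (A + 1))) (divr_gt0 e0 A1).
exists (maxn n0 n1) => m n; rewrite !geq_max => /andP[m0 m1] /andP[nn0 nn1].
rewrite WB; have := n1P n m nn1 m1.
move=> /(kobayashi_dist_pseudohyperbolic bP (uD _) (uD _)) /le_trans; apply.
rewrite -/(W (u n)) -/(W (u m)) -/K.
have le6 : rnorm (W (u m) + (W (u n))^*) <= 6 * (A + 1).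
  apply: le_trans (rnormD _ _) _.
  have -> : rnorm (W (u n))^* = rnorm (W (u n)) by rewrite /rnorm normcJ.
  have := WA n nn0; have := WA m m0; lra.
apply: le_trans (ler_wpM2l _ le6) _.
  by rewrite mulr_ge0 ?divr_ge0 // ltW.
rewrite le_eqVlt; apply/orP; left; apply/eqP; field.
by rewrite !gt_eqF // ltr_wpDl.
Qed.

Lemma kobayashi_cauchy_rnorm u : (forall n, D (u n)) ->
  cauchy_seq_for (kobayashi_dist D) u -> cauchy_rnorm u.
Proof.
move=> uD uc e e0.
have [c [M [cb M0 cM]]] := coercive_functionals D_domain D_convex D_no_line.
have d0 : 0 < e / (2 * M) by rewrite divr_gt0 // mulr_gt0.
have [n0 n0P] : {n0 : 'I_N -> nat & forall j m n, (n0 j <= m)%N ->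
    (n0 j <= n)%N -> rnorm (linform (c j) (u m - u n)) <= e / (2 * M)}.
  apply: (@choice 'I_N nat (fun j k => forall m n, (k <= m)%N -> (k <= n)%N ->
    rnorm (linform (c j) (u m - u n)) <= e / (2 * M))) => j.
  by have [b bP] := cb j; exact: cauchy_functional bP uD uc _ d0.
exists (\max_j n0 j)%N => m n /bigmax_leqP mP /bigmax_leqP nP.
apply: (@le_lt_trans _ _ (M * (e / (2 * M)))).
  by apply: cM => [|j]; [exact: ltW | apply: n0P; [exact: mP | exact: nP]].
have -> : M * (e / (2 * M)) = e / 2 by field; rewrite gt_eqF.
lra.
Qed.

(* A boundary point [z] is at infinite distance: for [x] in [D], a functional
   [W] with positive real part on [D] and vanishing at [z + (z - x) / 4]
   satisfies [W z = W x / 5], so that the pseudo-hyperbolic distance of [W y] to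
   [W x] is at least about [2 / 3] when [y] is near [z]. *)
Lemma kobayashi_cauchy_limit u z : (forall n, D (u n)) ->
  cauchy_seq_for (kobayashi_dist D) u -> cvg_rnorm u z -> D z.
Proof.
move=> uD uc uz; apply: contrapT => Dz.
have clz : closure D z.
  apply/closure_rnormP => r r0; have [n0 n0P] := uz r r0.
  by exists (u n0) => //; exact: n0P.
have [n0 n0P] := uc (1 / (2 * K)) (divr_gt0 ltr01 (mulr_gt0 (ltr0Sn _ 1) K0)).
pose x := u n0; have Dx : D x := uD n0.
pose z' := z + (1 / 4)%:C *: (z - x).
(* [z] lies at 4/5 of the segment from [x] to [z'], so it would be in [D] if [z'] were in the
   closure. *)
have clz' : ~ closure D z'.
  move=> clz'; apply: Dz.
  have -> : z = x + (4 / 5)%:C *: (z' - x).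
    rewrite /z'; apply/rowP => j; rewrite !mxE.
    case: (z ord0 j) (x ord0 j) => [a a'] [d d']; apply/eqP.
    by rewrite eq_complex /=; apply/andP; split; apply/eqP; field.
  by apply: convex_interior_segment => //; lra.
have [c [b [bP Wz']]] := strict_separation D_convex (ex_intro _ x Dx) clz'.
pose W y : R[i] := linform c y + b.
have Wz : W z = (1 / 5)%:C * W x.
  have E : W z' = W z + (1 / 4)%:C * (W z - W x).
    by rewrite /W /z' linformD linformZ linformB; ring.
  move: Wz'; rewrite -/(W z') E; move: (W z) (W x) => [a a'] [d d'] /eqP.
  rewrite eq_complex /= => /andP[/eqP ? /eqP ?].
  by apply/eqP; rewrite eq_complex /=; apply/andP; split; apply/eqP; lra.
pose A := rnorm (W x).
have A0 : 0 < A.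
  apply: lt_le_trans (le_trans (ler_norm _) (Re_le_rnorm _)); exact: bP.
have [L L0 LP] := linform_bound c.
(* Within [A / 10] of [W z], the numerator is at least [7 / 10 * A] and the denominator at most
   [13 / 10 * A], a quotient above 1/2. *)
have [n1 n1P] := uz (A / (10 * L)) (divr_gt0 A0 (mulr_gt0 (ltr0Sn _ 9) L0)).
pose n := maxn n0 n1.
have := n0P n0 n (leqnn _) (leq_maxl _ _).
move=> /(kobayashi_dist_pseudohyperbolic bP (uD _) (uD _)).
rewrite -/(W (u n)) -/(W (u n0)) -/x -/K.
have -> : K * (1 / (2 * K)) = 1 / 2 by field; rewrite gt_eqF.
have near_z : rnorm (W (u n) - W z) <= A / 10.
  have -> : W (u n) - W z = linform c (u n - z) by rewrite linformB /W; ring.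
  apply: le_trans (LP _) _; have := n1P n (leq_maxr _ _).
  rewrite -(ltr_pM2l L0); have -> : L * (A / (10 * L)) = A / 10.
    by field; rewrite gt_eqF.
  exact: ltW.
have zx : rnorm (W z - W x) = 4 / 5 * A.
  have -> : W z - W x = (- (4 / 5))%:C * W x.
    rewrite Wz; case: (W x) => d d'; apply/eqP; rewrite eq_complex /=.
    by apply/andP; split; apply/eqP; field.
  by rewrite rnormM rnorm_real normrN ger0_norm.
have zx' : rnorm (W z + (W x)^*) <= 6 / 5 * A.
  apply: le_trans (rnormD _ _) _; rewrite Wz rnormM rnorm_real.
  have -> : rnorm (W x)^* = A by rewrite /rnorm normcJ.
  have -> : `|1 / 5 : R| = 1 / 5 by apply: ger0_norm; lra.
  by rewrite -[rnorm (W x)]/A; move: (A) => A1; lra.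
have := ler_rnormB (W z) (W x) (W (u n)); rewrite zx rnormB => le1.
have := rnormD (W (u n) - W z) (W z + (W x)^*); rewrite addrA subrK.
lra.
Qed.

Theorem complete_hyperbolic_no_line : complete_hyperbolic D.
Proof.
split.
  split.
  - by move=> x y Dx Dy; rewrite kobayashi_dist_ge0 kobayashi_dist_fin.
  - move=> x y Dx Dy; split=> [|->]; first exact: kobayashi_dist_eq0.
    exact: kobayashi_dist_xx.
  - by move=> x y _ _; exact: kobayashi_dist_sym.
  - by move=> x y z Dx Dy Dz; apply: kobayashi_dist_triangle;
      exact: kobayashi_dist_fin.
move=> u uD uc.
have [z uz] := cauchy_cvg_rnorm (kobayashi_cauchy_rnorm uD uc).
have Dz := kobayashi_cauchy_limit uD uc uz.
exists z => //; have [r r0 rD] := open_rnorm D_open Dz.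
(* For [u n] within [r / 2] of [z], the balls of radius [r / 2] about both points lie in [D]. *)
have r2 : 0 < r / 2 by rewrite divr_gt0.
have dist_le n : rnorm (u n - z) < r / 2 ->
    (kobayashi_dist D (u n) z <= (rnorm (u n - z) / (r / 2))%:E)%E.
  move=> unz; rewrite rnormB; apply: kobayashi_dist_ball => // y yr; apply: rD.
    by have := ler_rnormB y z (u n); lra.
  by lra.
have dist_fin n : kobayashi_dist D (u n) z \is a fin_num.
  by rewrite ge0_fin_numE; [exact: kobayashi_dist_fin | exact: kobayashi_dist_ge0].
apply/fine_cvgP; split; first exact: nearW.
apply/cvgrPdist_lt => e e0; have re0 : 0 < e * (r / 2) by rewrite mulr_gt0.
have re1 : 0 < Num.min (r / 2) (e * (r / 2)) by rewrite lt_min r2.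
have [n0 n0P] := uz _ re1; exists n0 => // n /= /n0P.
rewrite lt_min sub0r normrN => /andP[/dist_le + lt_e].
move=> le_d; rewrite ger0_norm; last by apply: fine_ge0; exact: kobayashi_dist_ge0.
rewrite -lte_fin fineK //; apply: le_lt_trans le_d _.
by rewrite lte_fin ltr_pdivrMr.
Qed.


End Completeness.

(** * Complex lines and separating hyperplanes *)

Theorem corollary4p3 (R : realType) (N : nat) (D : set 'rV[R[i]]_N)
    (D_domain : is_domain D) (D_convex : is_convex D) :
  ((exists (p : 'rV[R[i]]_N) (H : set 'rV[R[i]]_N),
      [/\ boundary D p, separating_hyperplane D p H &
        ~ contains_complex_affine_line
            (translate (H `&` boundary D) p `&`
             imul (translate (H `&` boundary D) p))]) ->
   complete_hyperbolic D) /\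
  (complete_hyperbolic D ->
   forall (p : 'rV[R[i]]_N) (H : set 'rV[R[i]]_N),
     boundary D p -> separating_hyperplane D p H ->
     ~ contains_complex_affine_line
         (translate (H `&` boundary D) p `&`
          imul (translate (H `&` boundary D) p))).
Proof.
have [[x0 Dx0] Do _] := D_domain; split.
  move=> [p [H [bp [L [a [_ -> /= Lp DH]]] no_line]]].
  apply: complete_hyperbolic_no_line => // -[_ [q [v [v0 ->]]] qD].
  have {}qD (zeta : R[i]) : D (q + zeta *: v) by apply: qD; exists zeta.
  have D_off_H z : D z -> complex.Re (L z) <> a.
    by move=> Dz Lz; rewrite -[False]/(set0 z) -DH.
  (* Otherwise [L] takes every complex value on the line in [D], among them one on the
     hyperplane. *)
  have Lv : L v = 0.
    apply/eqP; apply: contrapT => /negP Lv0.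
    apply: (D_off_H (q + ((a%:C - L q) / L v) *: v)) => //.
    by rewrite linearD linearZ /= divfK // addrC subrK.
  have line_pD (zeta : R[i]) :
      translate ([set z | complex.Re (L z) = a] `&` boundary D) p (zeta *: v).
    exists (p + zeta *: v); last by rewrite addrAC subrr add0r.
    have Lpz : complex.Re (L (p + zeta *: v)) = a.
      by rewrite linearD linearZ /= Lv mulr0 addr0.
    split; first exact: Lpz.
    apply/(boundary_open _ Do); split; last by move/D_off_H; apply.
    have [/closure_rnormP clp _] : closure D p /\ ~ D p by apply/(boundary_open _ Do).
    apply/closure_rnormP => r /clp[y Dy yp]; exists (y + zeta *: v).
      by apply: (convex_line_direction (q := q)) => // xi; exact/subset_closure.
    by rewrite opprD addrACA subrr addr0.
  apply: no_line; exists [set 0 + zeta *: v | zeta in setT]; first by exists 0, v.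
  move=> _ [zeta _ <-]; rewrite add0r; split; first exact: line_pD.
  (* A complex line through 0 is invariant under multiplication by ['i], so it lies in the second
     factor too. *)
  exists ((zeta / 'i) *: v); first exact: line_pD.
  rewrite scalerA mulrC divfK //.
  by rewrite eq_complex /= oner_eq0 andbF.
move=> [[_ dist0 _ _] _] p H bp _ [_ [q [v [v0 ->]]] qH].
(* The first factor, moved back by [p], places the line in the closure of [D]. *)
have cl (zeta : R[i]) : closure D (p + q + zeta *: v).
  have [[z [_ bz] zE] _] := qH _ (ex_intro2 _ _ zeta I erefl).
  have [+ _] := (boundary_open z Do).1 bz.
  by rewrite -addrA -zE addrC subrK.
have xD (zeta : R[i]) : D (x0 + zeta *: v).
  exact: (convex_line_direction Do D_convex cl _ Dx0).
have := kobayashi_dist_line xD.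
have xvD := xD 1; rewrite scale1r in xvD.
move/(dist0 _ _ Dx0 xvD)/eqP; rewrite -subr_eq0 opprD addrA subrr add0r oppr_eq0.
by rewrite (negbTE v0).
Qed.
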